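(* For every $s\in(-2,13]\setminus\{0\}$, the triangular bi-pyramid is the unique minimizer (up to isometries of $S^2$) of the energy $\mathcal{E}_{R_s}(P)=\sum_{i<j}R_s(\|p_i-p_j\|)$ among all configurations $P=\{p_1,\dots,p_5\}$ of pairwise distinct points on the unit sphere $S^2\subset\mathbb{R}^3$, where $R_s(r)=\mathrm{sign}(s)\,r^{-s}$.
   Context: The triangular bi-pyramid is the configuration consisting of $(0,0,1)$, $(0,0,-1)$ and three points forming an equilateral triangle on the equator $\{z=0\}$ of $S^2$. *)

(* Defs.v *)
From Stdlib Require Import Reals Lra.
Open Scope R_scope.

Record pt := mkpt { px : R; py : R; pz : R }.

Definition dist3 (p q : pt) : R :=
  sqrt ((px p - px q)^2 + (py p - py q)^2 + (pz p - pz q)^2).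

Definition on_S2 (p : pt) : Prop := (px p)^2 + (py p)^2 + (pz p)^2 = 1.

Definition Rsign (s : R) : R := if Rlt_dec 0 s then 1 else if Rlt_dec s 0 then -1 else 0.

Definition Riesz (s r : R) : R := Rsign s * Rpower r (- s).

Definition config5 (p : nat -> pt) : Prop :=
  (forall i, (i < 5)%nat -> on_S2 (p i)) /\
  (forall i j, (i < 5)%nat -> (j < 5)%nat -> i <> j -> p i <> p j).

Definition energy (s : R) (p : nat -> pt) : R :=
  sum_f_R0 (fun i => sum_f (S i) 4 (fun j => Riesz s (dist3 (p i) (p j)))) 3.

Definition tbp (i : nat) : pt :=
  match i with
  | 0%nat => mkpt 0 0 1
  | 1%nat => mkpt 0 0 (-1)
  | 2%nat => mkpt 1 0 0
  | 3%nat => mkpt (-1/2) (sqrt 3 / 2) 0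
  | _ => mkpt (-1/2) (- (sqrt 3 / 2)) 0
  end.

(* isometry of S^2: a self-map of S^2 preserving (Euclidean, equivalently
   geodesic) distance *)
Definition isometry_S2 (f : pt -> pt) : Prop :=
  (forall x, on_S2 x -> on_S2 (f x)) /\
  (forall x y, on_S2 x -> on_S2 y -> dist3 (f x) (f y) = dist3 x y).

Definition isometric5 (p q : nat -> pt) : Prop :=
  exists f, isometry_S2 f /\
    (forall i, (i < 5)%nat -> exists j, (j < 5)%nat /\ p j = f (q i)) /\
    (forall j, (j < 5)%nat -> exists i, (i < 5)%nat /\ p j = f (q i)).

(* Main.v *)
(* Write y = 1 + <p_i, p_j> for a pair of points and t = s/2, so that the pair contributes
   g(y) = sign(s) (4 - 2y)^(-t); the bi-pyramid has y = 0 once, y = 1/2 three times and y = 1 six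
   times. The Hermite interpolant of g with nodes 0, 1/2, 1 of multiplicities 2, 4, 2 lies below g
   and touches it only at the nodes. Apart from two terms that are nonnegative on [0, 2), it is a
   constant plus a combination of
     y,  N2 = y(y-1/2),  N3 = y(y-1/2)^2,  P4,  P5
   whose coefficients are nonnegative for all -1 < t <= 13/2, the coefficient of P5 being positive.
   The constants in P4 and P5 were chosen numerically so that this holds and, at the same time, the
   bi-pyramid minimises the sum over all pairs of each of the five polynomials. For y this is
   |p_0 + ... + p_4|^2 >= 0; for the others the sum minus its minimum is the S_5-average of a sum of
   squares in the inner products, modulo the 4x4 minors of the Gram matrix, which has rank 3. These
   certificates were found by semidefinite programming and rounded to integers.

   The coefficients are combinations of 4^-t, 3^-t, 2^-t with polynomial coefficients; their sign is
   read off on segments of length at most 1, after bounding (3/4)^x and (3/2)^x by polynomial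
   interpolants, from the Bernstein coefficients of the resulting polynomials.

   In case of equality every y is a node and the sum of P5 is that of the bi-pyramid. By an
   arithmetic argument some y vanishes, which gives an antipodal pair, and then the other three
   points form an equilateral triangle on its equator. *)

Require Import Defs.
From Stdlib Require Import Reals ZArith List Lia Lra Bool Permutation.
Import ListNotations.
Open Scope R_scope.

(** * Polynomials as nested coefficient lists *)

(** The Newton coefficients of the interpolant are divided differences of g, positive for every t >
    0, but sums of Newton polynomials cannot all be minimal at the bi-pyramid: for large s a square
    pyramid, its base slightly below the equator, has energy about 4 * 2^(-s/2), against 6 *
    2^(-s/2). The obstruction is N3(y)(y-1). It vanishes at the nodes and is negative elsewhere on
    (0,1), so sliding one point of the triangle along the equator makes its sum negative. [P4]
    compensates it by y, N2 and N3, and [P5] also by a nonnegative multiple of N3(y)(y-1)^2. This is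
    paid for by the lower coefficients, and that is where the upper bound on t enters. The rank of
    the Gram matrix is essential too: the regular simplex in R^4, where every y is 3/4, has smaller
    sums of N2, N3, P4 and P5 than the bi-pyramid. Since the bi-pyramid attains the minimum, each
    square in a certificate, with its weight, must vanish at all labellings of it. The generators
    are chosen accordingly, so that their matrices can be positive definite, which leaves room for
    rounding. *)

Fixpoint poly (n : nat) : Type :=
  match n with O => Z | S n' => list (poly n') end.

Definition zipw {A} (f : A -> A -> A) : list A -> list A -> list A :=
  fix zip p q :=
    match p, q with
    | nil, _ => q
    | _, nil => p
    | a :: p', b :: q' => f a b :: zip p' q'
    end.

Definition pzero n : poly n :=
  match n return poly n with O => 0%Z | S _ => nil end.

Fixpoint padd n : poly n -> poly n -> poly n :=
  match n return poly n -> poly n -> poly n with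
  | O => Z.add
  | S n' => zipw (padd n')
  end.

(** A constant-time sufficient test for zero that lets [pmul] skip absent coefficients; lists with
    zero entries are left to [is_zero]. *)
Definition trivial_poly n : poly n -> bool :=
  match n return poly n -> bool with
  | O => Z.eqb 0
  | S n' => fun p => match p with nil => true | _ => false end
  end.

Fixpoint is_zero n : poly n -> bool :=
  match n return poly n -> bool with
  | O => Z.eqb 0
  | S n' => forallb (is_zero n')
  end.

Fixpoint pscale n (c : Z) : poly n -> poly n :=
  match n return poly n -> poly n with
  | O => Z.mul c
  | S n' => map (pscale n' c)
  end.

Fixpoint pmul n : poly n -> poly n -> poly n :=
  match n return poly n -> poly n -> poly n with
  | O => Z.mul
  | S n' => fun p q =>
      (fix mul p := match p with
        | nil => nil
        | a :: p' =>
            let r := match p' with nil => nil | _ => pzero n' :: mul p' end in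
            if trivial_poly n' a then r
            else zipw (padd n') (map (fun b => if trivial_poly n' b then pzero n' else pmul n' a b) q) r
        end) p
  end.

Fixpoint pmono n (e : list nat) (c : Z) : poly n :=
  match n return poly n with
  | O => c
  | S n' => repeat (pzero n') (hd 0%nat e) ++ [pmono n' (tl e) c]
  end.

Fixpoint peval (y : nat -> R) n k : poly n -> R :=
  match n return poly n -> R with
  | O => IZR
  | S n' => fix ev p := match p with
                        | nil => 0
                        | a :: p' => peval y n' (S k) a + y k * ev p'
                        end
  end.

Fixpoint meval (y : nat -> R) n k (e : list nat) : R :=
  match n with O => 1 | S n' => y k ^ hd 0%nat e * meval y n' (S k) (tl e) end.

Section Eval.
Variable y : nat -> R.

Lemma peval_zero n k : peval y n k (pzero n) = 0.
Proof. destruct n; reflexivity. Qed.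

Lemma peval_add n : forall k p q, peval y n k (padd n p q) = peval y n k p + peval y n k q.
Proof.
induction n as [|n IH]; intros k; [exact plus_IZR|].
induction p as [|a p IHp]; intros [|b q]; cbn -[Rplus]; try lra.
cbn in IHp. rewrite IH, IHp. lra.
Qed.

Lemma peval_trivial n k p : trivial_poly n p = true -> peval y n k p = 0.
Proof.
destruct n; cbn.
- destruct p; easy.
- destruct p; easy.
Qed.

Lemma peval_is_zero n : forall k p, is_zero n p = true -> peval y n k p = 0.
Proof.
induction n as [|n IH]; intros k p.
- destruct p; easy.
- induction p as [|a p IHp]; cbn; [reflexivity|].
  intros H. apply andb_true_iff in H as [H1 H2].
  cbn in IHp. rewrite (IH _ _ H1), (IHp H2). lra.
Qed.

Lemma peval_scale n c : forall k p, peval y n k (pscale n c p) = IZR c * peval y n k p.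
Proof.
induction n as [|n IH]; intros k p; [apply mult_IZR|].
induction p as [|a p IHp]; cbn; [lra|].
cbn in IHp. rewrite IH, IHp. lra.
Qed.

Lemma peval_mul n : forall k p q, peval y n k (pmul n p q) = peval y n k p * peval y n k q.
Proof.
induction n as [|n IH]; intros k p q; [apply mult_IZR|].
assert (Hmap : forall a,
  peval y (S n) k (map (fun b => if trivial_poly n b then pzero n else pmul n a b) q)
  = peval y n (S k) a * peval y (S n) k q).
{ intros a. induction q as [|b q IHq]; cbn; [lra|].
  cbn in IHq. rewrite IHq. destruct (trivial_poly n b) eqn:Hb.
  - rewrite peval_zero, (peval_trivial _ _ _ Hb). lra.
  - rewrite IH. lra. }
induction p as [|a p IHp]; [cbn; lra|].
set (r := match p with nil => nil | _ => pzero n :: pmul (S n) p q end : poly (S n)).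
assert (Hr : peval y (S n) k r = y k * (peval y (S n) k p * peval y (S n) k q)).
{ unfold r. destruct p as [|a' p']; [cbn; lra|].
  change (peval y n (S k) (pzero n) + y k * peval y (S n) k (pmul (S n) (a' :: p') q)
          = y k * (peval y (S n) k (a' :: p') * peval y (S n) k q)).
  rewrite peval_zero, IHp. lra. }
change (pmul (S n) (a :: p) q) with
  (if trivial_poly n a then r
   else padd (S n) (map (fun b => if trivial_poly n b then pzero n else pmul n a b) q) r).
change (peval y (S n) k (a :: p)) with (peval y n (S k) a + y k * peval y (S n) k p).
destruct (trivial_poly n a) eqn:Ha.
- rewrite Hr, (peval_trivial _ _ _ Ha). lra.
- rewrite peval_add, Hmap, Hr. lra.
Qed.

Lemma peval_mono n c : forall k e, peval y n k (pmono n e c) = IZR c * meval y n k e.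
Proof.
induction n as [|n IH]; intros k e; [cbn; lra|].
cbn [pmono meval].
induction (hd 0%nat e) as [|d IHd].
- cbn. rewrite IH. lra.
- cbn [repeat app].
  change (peval y (S n) k (pzero n :: repeat (pzero n) d ++ [pmono n (tl e) c]))
    with (peval y n (S k) (pzero n) + y k * peval y (S n) k (repeat (pzero n) d ++ [pmono n (tl e) c])).
  rewrite IHd, peval_zero. cbn. lra.
Qed.
End Eval.

(* Monomials occur both as exponent vectors (poly, meval) and as the list of their variables, with
   repetition (expo, mval, terms). *)
Fixpoint incr k (e : list nat) : list nat :=
  match k, e with
  | _, nil => nil
  | O, d :: e' => S d :: e'
  | S k', d :: e' => d :: incr k' e'
  end.

Definition expo n (m : list nat) : list nat := fold_right incr (repeat 0%nat n) m.

Fixpoint mval (y : nat -> R) (m : list nat) : R :=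
  match m with nil => 1 | k :: m' => y k * mval y m' end.

Lemma incr_length k : forall e, length (incr k e) = length e.
Proof. induction k; destruct e; cbn; auto. Qed.

Lemma expo_length n m : length (expo n m) = n.
Proof.
induction m; cbn; [apply repeat_length|]. now rewrite incr_length.
Qed.

Lemma meval_incr y n : forall j k e, (k < n)%nat -> length e = n ->
  meval y n j (incr k e) = y (j + k)%nat * meval y n j e.
Proof.
induction n as [|n IH]; intros j k e Hk He; [lia|].
destruct e as [|d e]; [discriminate|]. injection He as He.
destruct k as [|k]; cbn [incr meval hd tl pow].
- rewrite Nat.add_0_r. ring.
- rewrite IH by lia. replace (S j + k)%nat with (j + S k)%nat by lia. ring.
Qed.

Lemma meval_repeat0 y n : forall k, meval y n k (repeat 0%nat n) = 1.
Proof. induction n as [|n IH]; intros k; cbn; [reflexivity|]. rewrite IH. lra. Qed.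

Lemma meval_expo y n m : Forall (fun k => (k < n)%nat) m -> meval y n 0 (expo n m) = mval y m.
Proof.
induction 1 as [|k m Hk Hm IH]; [apply meval_repeat0|].
change (expo n (k :: m)) with (incr k (expo n m)). cbn [mval].
rewrite meval_incr by (assumption || apply expo_length). now rewrite IH.
Qed.

Fixpoint terms n k : poly n -> list (list nat * Z) :=
  match n return poly n -> list (list nat * Z) with
  | O => fun c => [(nil, c)]
  | S n' => fix tm p := match p with
      | nil => nil
      | a :: p' => terms n' (S k) a ++ map (fun t => (k :: fst t, snd t)) (tm p')
      end
  end.

Definition tsum (f : list nat -> R) (l : list (list nat * Z)) : R :=
  fold_right (fun t s => IZR (snd t) * f (fst t) + s) 0 l.

Lemma tsum_app f l1 l2 : tsum f (l1 ++ l2) = tsum f l1 + tsum f l2.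
Proof.
unfold tsum. induction l1 as [|t l1 IH]; cbn [app fold_right]; [lra|]. rewrite IH. lra.
Qed.

Lemma tsum_cons y k l :
  tsum (mval y) (map (fun t => (k :: fst t, snd t)) l) = y k * tsum (mval y) l.
Proof.
unfold tsum. induction l as [|t l IHl]; cbn [map fold_right fst snd mval]; [lra|].
rewrite IHl. ring.
Qed.

Lemma peval_terms y n : forall k p, peval y n k p = tsum (mval y) (terms n k p).
Proof.
induction n as [|n IH]; intros k p; [unfold tsum; cbn; lra|].
induction p as [|a p IHp]; [reflexivity|].
change (terms (S n) k (a :: p)) with
  (terms n (S k) a ++ map (fun t => (k :: fst t, snd t)) (terms (S n) k p)).
rewrite tsum_app, tsum_cons, <- IH, <- IHp. reflexivity.
Qed.

Lemma terms_bound n : forall k p,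
  Forall (fun t => Forall (fun j => (k <= j < k + n)%nat) (fst t)) (terms n k p).
Proof.
induction n as [|n IH]; intros k p; [cbn; constructor; constructor|].
induction p as [|a p IHp]; cbn; [constructor|].
apply Forall_app; split.
- eapply Forall_impl; [|apply IH]. intros t Ht.
  eapply Forall_impl; [|exact Ht]. cbn. lia.
- apply Forall_map. eapply Forall_impl; [|exact IHp].
  cbn. intros t Ht. constructor; [lia|exact Ht].
Qed.

(** * Symmetrisation over S_5 *)

Definition edges : list (nat * nat) :=
  [(0,1);(0,2);(0,3);(0,4);(1,2);(1,3);(1,4);(2,3);(2,4);(3,4)]%nat.

Definition eidx (i j : nat) : nat :=
  match i, j with
  | 0, 1 | 1, 0 => 0 | 0, 2 | 2, 0 => 1 | 0, 3 | 3, 0 => 2 | 0, 4 | 4, 0 => 3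
  | 1, 2 | 2, 1 => 4 | 1, 3 | 3, 1 => 5 | 1, 4 | 4, 1 => 6
  | 2, 3 | 3, 2 => 7 | 2, 4 | 4, 2 => 8 | _, _ => 9
  end%nat.

Definition at_ (s : list nat) (i : nat) : nat := nth i s 0%nat.

Definition compose (p s : list nat) : list nat := map (at_ p) s.

Definition eperm (s : list nat) : list nat :=
  map (fun e => eidx (at_ s (fst e)) (at_ s (snd e))) edges.

Definition swaps : list (list nat) :=
  [[1;0;2;3;4]; [0;2;1;3;4]; [0;1;3;2;4]; [0;1;2;4;3]]%nat.

(* Every element of S_5 is uniquely a product d_0 d_1 d_2 d_3 where d_i is an
   initial segment of s_i s_(i-1) ... s_0, the s_i being the adjacent swaps. *)
Fixpoint descents (i : nat) : list (list nat) :=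
  match i with
  | O => [nil; [0%nat]]
  | S i' => nil :: map (cons i) (descents i')
  end.

Definition words : list (list nat) :=
  flat_map (fun a => flat_map (fun b => flat_map (fun c =>
    map (fun d => a ++ b ++ c ++ d) (descents 3)) (descents 2)) (descents 1)) (descents 0).

Definition eword (w : list nat) : list nat :=
  fold_right (fun i p => compose (eperm (nth i swaps nil)) p) (seq 0 10) w.

Definition eperms : list (list nat) := map eword words.

Fixpoint eqbl (l1 l2 : list nat) : bool :=
  match l1, l2 with
  | nil, nil => true
  | a :: l1', b :: l2' => Nat.eqb a b && eqbl l1' l2'
  | _, _ => false
  end.

Lemma eqbl_spec l1 : forall l2, eqbl l1 l2 = true <-> l1 = l2.
Proof.
induction l1 as [|a l1 IH]; intros [|b l2]; cbn; split; try easy.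
- intros H. apply andb_true_iff in H as [H1 H2].
  apply Nat.eqb_eq in H1. apply IH in H2. now subst.
- intros H. injection H as -> H. rewrite Nat.eqb_refl. now apply IH.
Qed.

Definition memb (a : list nat) (l : list (list nat)) : bool := existsb (eqbl a) l.

Lemma memb_In a l : memb a l = true <-> In a l.
Proof.
unfold memb. rewrite existsb_exists. split.
- intros [b [Hb Hab]]. apply eqbl_spec in Hab. now subst.
- intros H. exists a. split; [easy|]. now apply eqbl_spec.
Qed.

Fixpoint nodupb (l : list (list nat)) : bool :=
  match l with nil => true | a :: l' => negb (memb a l') && nodupb l' end.

Lemma nodupb_NoDup l : nodupb l = true -> NoDup l.
Proof.
induction l as [|a l IH]; cbn; intros H; constructor.
- apply andb_true_iff in H as [H _]. rewrite negb_true_iff in H.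
  intros Ha. apply memb_In in Ha. congruence.
- apply andb_true_iff in H as [_ H]. now apply IH.
Qed.

Definition closed_under (s : list nat) : bool :=
  let l := map (fun p => compose p s) eperms in
  forallb (fun q => memb q eperms) l && nodupb l
  && forallb (fun k => Nat.ltb k 10) s && Nat.eqb (length s) 10.

Lemma swaps_closed : forallb (fun s => closed_under (eperm s)) swaps = true.
Proof. vm_compute. reflexivity. Qed.

(** Invariance under S_5 reduces to its four generators: right multiplication by a swap maps the
    listed permutations into themselves without repetition, hence permutes them. *)
Lemma swap_spec i : (i < 4)%nat ->
  let s := eperm (nth i swaps nil) in
  Permutation (map (fun p => compose p s) eperms) eperms
  /\ Forall (fun k => (k < 10)%nat) s /\ length s = 10%nat.
Proof.
intros Hi. cbv zeta. pose proof swaps_closed as H.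
rewrite forallb_forall in H.
specialize (H (nth i swaps nil) (nth_In swaps nil Hi)). unfold closed_under in H. cbv zeta in H.
rewrite !andb_true_iff, !forallb_forall in H. destruct H as [[[H1 H2] H3] H4].
repeat split.
- apply NoDup_Permutation_bis.
  + now apply nodupb_NoDup.
  + now rewrite length_map.
  + intros q Hq. apply memb_In. auto.
- apply Forall_forall. intros k Hk. apply Nat.ltb_lt. auto.
Qed.

Lemma words_bound : forallb (forallb (fun i => Nat.ltb i 4)) words = true.
Proof. vm_compute. reflexivity. Qed.

Lemma at_compose p s k : (k < length s)%nat -> at_ (compose p s) k = at_ p (at_ s k).
Proof.
intros Hk. unfold compose, at_.
rewrite (nth_indep (map _ s) 0%nat ((fun i => nth i p 0%nat) 0%nat)) by now rewrite length_map.
exact (map_nth (fun i => nth i p 0%nat) s 0%nat k).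
Qed.

Lemma eword_spec w : Forall (fun i => (i < 4)%nat) w ->
  Forall (fun k => (k < 10)%nat) (eword w) /\ length (eword w) = 10%nat.
Proof.
induction 1 as [|i w Hi Hw [IH1 IH2]].
- split; [|easy]. apply Forall_forall. intros k Hk. apply in_seq in Hk. lia.
- change (eword (i :: w)) with (compose (eperm (nth i swaps nil)) (eword w)).
  unfold compose. rewrite length_map. split; [|easy].
  destruct (swap_spec i Hi) as [_ [Hb Hlen]]. cbv zeta in Hb, Hlen.
  apply Forall_map. eapply Forall_impl; [|exact IH1]. intros k Hk.
  rewrite Forall_forall in Hb. apply Hb. apply nth_In. now rewrite Hlen.
Qed.

Definition lsum {A} (f : A -> R) (l : list A) : R := fold_right (fun a s => f a + s) 0 l.

Lemma lsum_perm {A} (f : A -> R) l1 l2 : Permutation l1 l2 -> lsum f l1 = lsum f l2.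
Proof. unfold lsum. induction 1; cbn [fold_right]; lra. Qed.

Lemma lsum_map {A B} (g : A -> B) (f : B -> R) l : lsum f (map g l) = lsum (fun a => f (g a)) l.
Proof. unfold lsum. induction l as [|a l IH]; cbn [map fold_right]; [easy|]. now rewrite IH. Qed.

Lemma lsum_ext {A} (f g : A -> R) l : (forall a, In a l -> f a = g a) -> lsum f l = lsum g l.
Proof.
unfold lsum. induction l as [|a l IH]; cbn [fold_right]; intros H; [easy|].
rewrite (H a) by now left. rewrite IH; [easy|]. intros b Hb. apply H. now right.
Qed.

Lemma lsum_0 {A} (l : list A) : lsum (fun _ => 0) l = 0.
Proof. unfold lsum. induction l; cbn [fold_right]; lra. Qed.

Lemma lsum_plus {A} (f g : A -> R) l : lsum (fun a => f a + g a) l = lsum f l + lsum g l.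
Proof. unfold lsum. induction l as [|a l IH]; cbn [fold_right]; lra. Qed.

Lemma lsum_scal {A} c (f : A -> R) l : lsum (fun a => c * f a) l = c * lsum f l.
Proof. unfold lsum. induction l as [|a l IH]; cbn [fold_right]; [|rewrite IH]; ring. Qed.

Lemma lsum_le {A} (f g : A -> R) l : (forall a, In a l -> f a <= g a) -> lsum f l <= lsum g l.
Proof.
unfold lsum. induction l as [|a l IH]; cbn [fold_right]; intros H; [lra|].
apply Rplus_le_compat; [apply H; now left|]. apply IH. intros b Hb. apply H. now right.
Qed.

Lemma lsum_nonneg {A} (f : A -> R) l : (forall a, In a l -> 0 <= f a) -> 0 <= lsum f l.
Proof. intros H. rewrite <- (lsum_0 l). now apply lsum_le. Qed.

Lemma lsum_swap {A B} (f : A -> B -> R) l1 l2 :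
  lsum (fun a => lsum (f a) l2) l1 = lsum (fun b => lsum (fun a => f a b) l1) l2.
Proof.
induction l1 as [|a l1 IH].
- symmetry. apply lsum_0.
- change (lsum (f a) l2 + lsum (fun a => lsum (f a) l2) l1
          = lsum (fun b => f a b + lsum (fun a => f a b) l1) l2).
  now rewrite IH, lsum_plus.
Qed.

Definition relabel (x : nat -> R) (p : list nat) : nat -> R := fun k => x (at_ p k).

Lemma mval_map x p s m : Forall (fun k => (k < length s)%nat) m ->
  mval (relabel x p) (map (at_ s) m) = mval (relabel x (compose p s)) m.
Proof.
induction 1 as [|k m Hk Hm IH]; cbn [map mval]; [easy|]. rewrite IH. f_equal.
unfold relabel. now rewrite at_compose.
Qed.

(* A trie sends the exponent vector of a monomial to a chosen representative of its orbit. *)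
Fixpoint trie (n : nat) : Type :=
  match n with O => option (list nat) | S n' => list (trie n') end.

Definition tempty n : trie n := match n return trie n with O => None | S _ => nil end.

Fixpoint upd {A} (d : A) (f : A -> A) i (l : list A) : list A :=
  match i, l with
  | O, nil => [f d]
  | O, a :: l' => f a :: l'
  | S i', nil => d :: upd d f i' nil
  | S i', a :: l' => a :: upd d f i' l'
  end.

Fixpoint tset n (e : list nat) (v : list nat) : trie n -> trie n :=
  match n return trie n -> trie n with
  | O => fun _ => Some v
  | S n' => upd (tempty n') (tset n' (tl e) v) (hd 0%nat e)
  end.

Fixpoint tget n (e : list nat) : trie n -> option (list nat) :=
  match n return trie n -> option (list nat) with
  | O => fun t => t
  | S n' => fun t => tget n' (tl e) (nth (hd 0%nat e) t (tempty n'))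
  end.

Lemma tget_empty n : forall e, tget n e (tempty n) = None.
Proof.
induction n as [|n IH]; intros e; [easy|].
cbn. destruct (hd 0%nat e); apply IH.
Qed.

Lemma nth_upd {A} (d : A) f : forall i j l,
  nth j (upd d f i l) d = if Nat.eqb i j then f (nth j l d) else nth j l d.
Proof.
induction i as [|i IH]; intros [|j] [|a l]; cbn; try easy.
- now destruct j.
- rewrite IH. now destruct j.
Qed.

Lemma tget_tset n : forall e e' v t, length e = n -> length e' = n ->
  tget n e (tset n e' v t) = Some v /\ e = e' \/ tget n e (tset n e' v t) = tget n e t.
Proof.
induction n as [|n IH]; intros e e' v t He He'.
- left. destruct e, e'; easy.
- destruct e as [|i e], e' as [|i' e']; try discriminate.
  injection He as He. injection He' as He'. cbn [tget tset hd tl].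
  rewrite nth_upd. destruct (Nat.eqb_spec i' i) as [->|]; [|now right].
  destruct (IH e e' v (nth i t (tempty n)) He He') as [[H ->]|H]; auto.
Qed.

(** Run at the first monomial met in an orbit: all its images are sent to the exponents of that
    monomial, so every later member of the orbit costs one lookup. *)
Definition add_orbit (m : list nat) (t : trie 10) : trie 10 :=
  let e := expo 10 m in
  fold_left (fun t s => tset 10 (expo 10 (map (at_ s) m)) e t) eperms t.

Definition collect (t : trie 10 * poly 10) (u : list nat * Z) : trie 10 * poly 10 :=
  let e := expo 10 (fst u) in
  match tget 10 e (fst t) with
  | Some r => (fst t, padd 10 (pmono 10 r (snd u)) (snd t))
  | None => (add_orbit (fst u) (fst t), padd 10 (pmono 10 e (snd u)) (snd t))
  end.

Definition symmetric_zero (p : poly 10) : bool :=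
  is_zero 10 (snd (fold_left collect (terms 10 0 p) (tempty 10, pzero 10))).

Section Symmetrisation.
Variable x : nat -> R.

Definition symval (m : list nat) : R := lsum (fun p => mval (relabel x p) m) eperms.

Definition symexp (e : list nat) : R := lsum (fun p => meval (relabel x p) 10 0 e) eperms.

Definition symeval (p : poly 10) : R := lsum (fun s => peval (relabel x s) 10 0 p) eperms.

Lemma symval_expo m : Forall (fun k => (k < 10)%nat) m -> symexp (expo 10 m) = symval m.
Proof. intros Hm. apply lsum_ext. intros. now apply meval_expo. Qed.

Lemma symval_swap i m : (i < 4)%nat -> Forall (fun k => (k < 10)%nat) m ->
  symval (map (at_ (eperm (nth i swaps nil))) m) = symval m.
Proof.
intros Hi Hm. destruct (swap_spec i Hi) as [HP [_ Hlen]]. cbv zeta in HP, Hlen. unfold symval.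
transitivity (lsum (fun p => mval (relabel x p) m)
                   (map (fun p => compose p (eperm (nth i swaps nil))) eperms)).
- rewrite lsum_map. apply lsum_ext. intros p _. apply mval_map. now rewrite Hlen.
- now apply lsum_perm.
Qed.

Lemma map_at_bound s m : Forall (fun k => (k < 10)%nat) s -> length s = 10%nat ->
  Forall (fun k => (k < 10)%nat) m -> Forall (fun k => (k < 10)%nat) (map (at_ s) m).
Proof.
intros Hs Hlen Hm. apply Forall_map. eapply Forall_impl; [|exact Hm]. intros k Hk.
rewrite Forall_forall in Hs. apply Hs. apply nth_In. now rewrite Hlen.
Qed.

Lemma symval_map w m : Forall (fun i => (i < 4)%nat) w -> Forall (fun k => (k < 10)%nat) m ->
  symval (map (at_ (eword w)) m) = symval m.
Proof.
intros Hw Hm. induction Hw as [|i w Hi Hw IH].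
- f_equal. rewrite <- (map_id m) at 2. apply map_ext_in. intros k Hk.
  rewrite Forall_forall in Hm. apply seq_nth. auto.
- destruct (eword_spec w Hw) as [Hb Hlen].
  rewrite <- IH, <- (symval_swap i _ Hi (map_at_bound _ m Hb Hlen Hm)).
  f_equal. rewrite map_map. apply map_ext_in. intros k Hk.
  apply at_compose. rewrite Hlen. rewrite Forall_forall in Hm. auto.
Qed.

Lemma symeval_terms p : symeval p = tsum symval (terms 10 0 p).
Proof.
unfold symeval.
transitivity (lsum (fun s => tsum (mval (relabel x s)) (terms 10 0 p)) eperms).
{ apply lsum_ext. intros. apply peval_terms. }
generalize (terms 10 0 p). intros l. induction l as [|t l IH].
- apply lsum_0.
- change (lsum (fun s => IZR (snd t) * mval (relabel x s) (fst t)
                         + tsum (mval (relabel x s)) l) eperms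
          = IZR (snd t) * symval (fst t) + tsum symval l).
  rewrite lsum_plus, lsum_scal, IH. reflexivity.
Qed.

(** A trie that misses monomials, or gives an orbit several representatives, could only make
    [symmetric_zero] fail; correctness rests on this property. *)
Definition sound (t : trie 10) : Prop :=
  forall e r, length e = 10%nat -> tget 10 e t = Some r -> symexp e = symexp r.

Lemma sound_empty : sound (tempty 10).
Proof. intros e r _. now rewrite tget_empty. Qed.

Lemma sound_orbit m t : Forall (fun k => (k < 10)%nat) m -> sound t -> sound (add_orbit m t).
Proof.
intros Hm. unfold add_orbit. cbv zeta.
unfold eperms. pose proof words_bound as Hwords. revert Hwords t.
generalize words. intros l. induction l as [|w l IH]; intros Hl t Ht; [easy|].
cbn [map]. cbn [forallb] in Hl. apply andb_true_iff in Hl as [Hw Hl].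
set (s := eword w).
cbn [fold_left]. apply IH; [easy|].
intros e r He.
destruct (tget_tset 10 e (expo 10 (map (at_ s) m)) (expo 10 m) t He (expo_length _ _))
  as [[H ->]|H]; rewrite H; [|now apply Ht].
intros [= <-].
assert (Hw' : Forall (fun i => (i < 4)%nat) w).
{ rewrite forallb_forall in Hw. apply Forall_forall. intros i Hi. apply Nat.ltb_lt. auto. }
destruct (eword_spec w Hw') as [Hb Hlen].
rewrite !symval_expo; auto using map_at_bound. now apply symval_map.
Qed.

Lemma symeval_add p q : symeval (padd 10 p q) = symeval p + symeval q.
Proof.
unfold symeval. rewrite <- lsum_plus. apply lsum_ext. intros. apply peval_add.
Qed.

Lemma symeval_mono e c : symeval (pmono 10 e c) = IZR c * symexp e.
Proof.
unfold symeval, symexp. rewrite <- lsum_scal. apply lsum_ext. intros. apply peval_mono.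
Qed.

Lemma collect_sum l : forall t, sound (fst t) ->
  Forall (fun u => Forall (fun k => (k < 10)%nat) (fst u)) l ->
  symeval (snd (fold_left collect l t)) = symeval (snd t) + tsum symval l.
Proof.
induction l as [|u l IH]; intros t Ht Hl; [symmetry; apply Rplus_0_r|].
inversion_clear Hl as [|? ? Hu Hl'].
change (tsum symval (u :: l)) with (IZR (snd u) * symval (fst u) + tsum symval l).
cbn [fold_left]. unfold collect at 2. cbv zeta.
destruct (tget 10 (expo 10 (fst u)) (fst t)) as [r|] eqn:Hr.
- rewrite IH; auto. cbn [snd]. rewrite symeval_add, symeval_mono.
  rewrite <- (Ht _ _ (expo_length _ _) Hr), (symval_expo _ Hu). lra.
- rewrite IH; auto; [|now apply sound_orbit]. cbn [snd]. rewrite symeval_add, symeval_mono.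
  rewrite (symval_expo _ Hu). lra.
Qed.

Lemma symmetric_zero_spec p : symmetric_zero p = true -> symeval p = 0.
Proof.
intros H. rewrite symeval_terms.
assert (Hz : symeval (snd (fold_left collect (terms 10 0 p) (tempty 10, pzero 10))) = 0).
{ unfold symeval. rewrite <- (lsum_0 eperms). apply lsum_ext. intros. now apply peval_is_zero. }
rewrite collect_sum in Hz.
- assert (H0 : symeval (pzero 10) = 0).
  { unfold symeval. rewrite <- (lsum_0 eperms). apply lsum_ext. intros. apply peval_zero. }
  cbn [snd] in Hz. lra.
- apply sound_empty.
- eapply Forall_impl; [|apply terms_bound]. intros u Hu.
  eapply Forall_impl; [|exact Hu]. cbn. lia.
Qed.
End Symmetrisation.

(** * Positive semidefinite forms *)

Fixpoint zdot (l1 l2 : list Z) : Z :=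
  match l1, l2 with
  | a :: l1', b :: l2' => (a * b + zdot l1' l2')%Z
  | _, _ => 0%Z
  end.

(* Symmetric matrices are given by the rows of their lower triangle. *)
Definition sym_entry (Q : list (list Z)) (i j : nat) : Z :=
  if Nat.leb j i then nth j (nth i Q nil) 0%Z else nth i (nth j Q nil) 0%Z.

Definition residual Q L (c : Z) (i j : nat) : Z :=
  (sym_entry Q i j - c * zdot (nth i L nil) (nth j L nil))%Z.

(* [Q - c L L^T] is diagonally dominant. *)
Definition dominant Q L c : bool :=
  let I := seq 0 (length Q) in
  Z.leb 0 c &&
  forallb (fun i => Z.leb (fold_right (fun j s => Z.abs (residual Q L c i j) + s)%Z 0%Z I)
                          (2 * residual Q L c i i)) I.

Lemma sym_entry_comm Q i j : sym_entry Q i j = sym_entry Q j i.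
Proof.
unfold sym_entry. destruct (Nat.leb_spec j i), (Nat.leb_spec i j); try easy; try lia.
now replace j with i by lia.
Qed.

Lemma zdot_comm l1 : forall l2, zdot l1 l2 = zdot l2 l1.
Proof. induction l1 as [|a l1 IH]; intros [|b l2]; cbn; try easy. rewrite IH. lia. Qed.

Lemma lsum_seq_S f a n : lsum f (seq a (S n)) = f a + lsum (fun i => f (S i)) (seq a n).
Proof.
change (seq a (S n)) with (a :: seq (S a) n). rewrite <- seq_shift.
change (f a + lsum f (map S (seq a n)) = f a + lsum (fun i => f (S i)) (seq a n)).
now rewrite lsum_map.
Qed.

Lemma zdot_lsum n : forall l1 l2, (length l1 <= n)%nat ->
  IZR (zdot l1 l2) = lsum (fun k => IZR (nth k l1 0%Z) * IZR (nth k l2 0%Z)) (seq 0 n).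
Proof.
induction n as [|n IH]; intros [|a l1] l2 H; cbn [length] in H; try lia; [easy| |].
- cbn [zdot]. rewrite <- (lsum_0 (seq 0 (S n))). apply lsum_ext. intros k _.
  destruct k; cbn; ring.
- rewrite lsum_seq_S. destruct l2 as [|b l2].
  + cbn [zdot nth]. rewrite (lsum_ext _ (fun _ => 0)).
    * rewrite lsum_0. ring.
    * intros k _. destruct k; cbn; ring.
  + cbn [zdot nth]. rewrite plus_IZR, mult_IZR, (IH l1 l2) by lia. reflexivity.
Qed.

Lemma lsum_delta i r c : (i < r)%nat ->
  lsum (fun j => if Nat.eqb i j then c else 0) (seq 0 r) = c.
Proof.
revert i. induction r as [|r IH]; intros i Hi; [lia|].
rewrite lsum_seq_S. destruct i as [|i]; cbn [Nat.eqb].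
- rewrite lsum_0. ring.
- rewrite IH by lia. ring.
Qed.

Lemma IZR_fold_abs (f : nat -> Z) l :
  IZR (fold_right (fun j s => Z.abs (f j) + s)%Z 0%Z l) = lsum (fun j => Rabs (IZR (f j))) l.
Proof.
induction l as [|a l IH]; [easy|].
cbn [fold_right]. rewrite plus_IZR, IH, abs_IZR. reflexivity.
Qed.

Lemma lsum_double (l : list nat) (f g : nat -> nat -> R) :
  (forall i j, In i l -> In j l -> f i j <= g i j) ->
  lsum (fun i => lsum (f i) l) l <= lsum (fun i => lsum (g i) l) l.
Proof. intros H. apply lsum_le. intros i Hi. apply lsum_le. auto. Qed.

(** The part c L L^T contributes c |L^T z|^2. The residual E is handled by |E_ij z_i z_j| <= |E_ij|
    (z_i^2 + z_j^2) / 2. The row sums in [dominant] include the diagonal entry, whence the factor 2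
    there, which also forces E_ii >= 0. *)
Lemma dominant_psd Q L c : dominant Q L c = true -> forall z : nat -> R,
  let I := seq 0 (length Q) in
  0 <= lsum (fun i => lsum (fun j => IZR (sym_entry Q i j) * (z i * z j)) I) I.
Proof.
intros H z. cbv zeta. unfold dominant in H. cbv zeta in H.
set (r := length Q) in *. set (I := seq 0 r) in *.
apply andb_true_iff in H as [Hc Hd]. apply Z.leb_le in Hc. rewrite forallb_forall in Hd.
set (E := fun i j => IZR (residual Q L c i j)).
assert (HE : forall i j, E i j = E j i).
{ intros i j. unfold E, residual. now rewrite sym_entry_comm, zdot_comm. }
assert (Hrow : forall i, In i I -> lsum (fun j => Rabs (E i j)) I <= 2 * E i i).
{ intros i Hi. specialize (Hd i Hi). apply Z.leb_le, IZR_le in Hd.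
  rewrite IZR_fold_abs, mult_IZR in Hd. exact Hd. }
set (N := list_max (map (@length Z) L)).
set (l := fun i k => IZR (nth k (nth i L nil) 0%Z)).
assert (Hl : forall i j, IZR (zdot (nth i L nil) (nth j L nil))
                         = lsum (fun k => l i k * l j k) (seq 0 N)).
{ intros i j. apply zdot_lsum. unfold N.
  destruct (Nat.lt_ge_cases i (length L)) as [Hi|Hi].
  - assert (HF := proj1 (list_max_le (map (@length Z) L) _) (Nat.le_refl _)).
    rewrite Forall_forall in HF. apply HF, in_map, nth_In, Hi.
  - rewrite nth_overflow by easy. cbn. lia. }
assert (HL : 0 <= lsum (fun i => lsum (fun j =>
               IZR (zdot (nth i L nil) (nth j L nil)) * (z i * z j)) I) I).
{ apply Rle_trans with (lsum (fun k => (lsum (fun i => l i k * z i) I) *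
                                       (lsum (fun i => l i k * z i) I)) (seq 0 N)).
  - apply lsum_nonneg. intros k _. apply Rle_0_sqr.
  - right. symmetry.
    transitivity (lsum (fun i => lsum (fun k => lsum (fun j => l i k * z i * (l j k * z j)) I)
                                      (seq 0 N)) I).
    + apply lsum_ext. intros i _. rewrite <- (lsum_swap (fun j k => l i k * z i * (l j k * z j))).
      apply lsum_ext. intros j _.
      rewrite Hl, Rmult_comm, <- lsum_scal. apply lsum_ext. intros. ring.
    + rewrite (lsum_swap (fun i k => lsum (fun j => l i k * z i * (l j k * z j)) I)).
      apply lsum_ext. intros k _.
      rewrite <- lsum_scal. apply lsum_ext. intros i _. rewrite lsum_scal. ring. }
assert (HR : 0 <= lsum (fun i => lsum (fun j => E i j * (z i * z j)) I) I).
{ apply Rle_trans with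
    (lsum (fun i => (2 * E i i - lsum (fun j => Rabs (E i j)) I) * (z i * z i)) I).
  - apply lsum_nonneg. intros i Hi.
    apply Rmult_le_pos; [specialize (Hrow i Hi); lra | apply Rle_0_sqr].
  (* Entrywise lower bounds for E_ij z_i z_j. On the diagonal the bound is an equality: 2 E_ii z_i^2
     minus two halves of |E_ii| z_i^2. *)
  - apply Rle_trans with (lsum (fun i => lsum (fun j =>
      (if Nat.eqb i j then 2 * E i i * (z i * z i) else 0)
      + (- / 2 * (z i * z i) * Rabs (E i j) + - / 2 * (z j * z j) * Rabs (E j i))) I) I).
    + right. symmetry.
      transitivity (lsum (fun i => 2 * E i i * (z i * z i)
        + (- / 2 * (z i * z i) * lsum (fun j => Rabs (E i j)) I
           + lsum (fun j => - / 2 * (z j * z j) * Rabs (E j i)) I)) I).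
      * apply lsum_ext. intros i Hi. rewrite lsum_plus, lsum_plus, lsum_scal.
        assert (Hd' := lsum_delta i r (2 * E i i * (z i * z i))). fold I in Hd'.
        rewrite Hd' by (apply in_seq in Hi; lia). reflexivity.
      * rewrite lsum_plus, lsum_plus,
          (lsum_swap (fun i j => - / 2 * (z j * z j) * Rabs (E j i))), <- lsum_plus, <- lsum_plus.
        apply lsum_ext. intros i _. rewrite lsum_scal. field.
    + apply lsum_double. intros i j Hi Hj. rewrite (HE j i).
      destruct (Nat.eqb_spec i j) as [<-|_].
      * assert (0 <= E i i).
        { specialize (Hrow i Hi). assert (0 <= lsum (fun j => Rabs (E i j)) I); [|lra].
          apply lsum_nonneg. intros. apply Rabs_pos. }
        rewrite Rabs_pos_eq by easy. lra.
      * assert (0 <= Rabs (E i j) * ((z i + z j) * (z i + z j))).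
        { apply Rmult_le_pos; [apply Rabs_pos | apply Rle_0_sqr]. }
        assert (0 <= Rabs (E i j) * ((z i - z j) * (z i - z j))).
        { apply Rmult_le_pos; [apply Rabs_pos | apply Rle_0_sqr]. }
        destruct (Rcase_abs (E i j)) as [Hn|Hp].
        -- rewrite (Rabs_left _ Hn) in *. lra.
        -- rewrite (Rabs_right _ Hp) in *. lra. }
replace (lsum _ I) with
  (IZR c * lsum (fun i => lsum (fun j =>
               IZR (zdot (nth i L nil) (nth j L nil)) * (z i * z j)) I) I
   + lsum (fun i => lsum (fun j => E i j * (z i * z j)) I) I).
- apply Rplus_le_le_0_compat; [apply Rmult_le_pos; [now apply (IZR_le 0)|]|]; easy.
- rewrite <- lsum_scal, <- lsum_plus. apply lsum_ext. intros i _.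
  rewrite <- lsum_scal, <- lsum_plus. apply lsum_ext. intros j _.
  unfold E, residual. rewrite minus_IZR, mult_IZR. ring.
Qed.

(* [x] lists the ten inner products of five unit vectors [(a i, b i, c i)]. *)
Definition gram_of (a b c : nat -> R) (x : nat -> R) : Prop :=
  (forall i, (i < 5)%nat -> a i * a i + b i * b i + c i * c i = 1) /\
  (forall i j, (i < 5)%nat -> (j < 5)%nat -> i <> j ->
     x (eidx i j) = a i * a j + b i * b j + c i * c j).

Definition gram (x : nat -> R) : Prop := exists a b c, gram_of a b c x.

Lemma gram_swap i x : (i < 4)%nat -> gram x -> gram (relabel x (eperm (nth i swaps nil))).
Proof.
intros Hi [a [b [c [H1 Hx]]]].
set (v := nth i swaps nil).
exists (fun k => a (at_ v k)), (fun k => b (at_ v k)), (fun k => c (at_ v k)).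
assert (Hv : forall j, (j < 5)%nat -> (at_ v j < 5)%nat).
{ unfold v. intros j Hj. destruct i as [|[|[|[|]]]]; try lia;
    destruct j as [|[|[|[|[|]]]]]; try lia; cbn; lia. }
assert (Hd : forall j k, (j < 5)%nat -> (k < 5)%nat -> j <> k ->
  at_ v j <> at_ v k /\ at_ (eperm v) (eidx j k) = eidx (at_ v j) (at_ v k)).
{ unfold v. intros j k Hj Hk Hjk. destruct i as [|[|[|[|]]]]; try lia;
    destruct j as [|[|[|[|[|]]]]]; try lia; destruct k as [|[|[|[|[|]]]]]; try lia;
    split; cbn; (reflexivity || lia). }
split.
- intros j Hj. auto.
- intros j k Hj Hk Hjk. destruct (Hd j k Hj Hk Hjk) as [Hne He].
  unfold relabel. rewrite He. auto.
Qed.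

Lemma eidx_bound i j : (eidx i j < 10)%nat.
Proof.
destruct i as [|[|[|[|[|]]]]]; destruct j as [|[|[|[|[|]]]]]; cbn; lia.
Qed.

Lemma gram_ext x y : (forall k, (k < 10)%nat -> x k = y k) -> gram x -> gram y.
Proof.
intros Hxy [a [b [c [H1 Hx]]]]. exists a, b, c. split; [easy|].
intros i j Hi Hj Hij. rewrite <- Hxy by apply eidx_bound. auto.
Qed.

Lemma gram_relabel x s : In s eperms -> gram x -> gram (relabel x s).
Proof.
intros Hs. unfold eperms in Hs. apply in_map_iff in Hs as [w [<- Hw]].
assert (Hb : Forall (fun i => (i < 4)%nat) w).
{ pose proof words_bound as H. rewrite forallb_forall in H. specialize (H w Hw).
  rewrite forallb_forall in H. apply Forall_forall. intros i Hi. apply Nat.ltb_lt. auto. }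
clear Hw. revert x. induction Hb as [|i w Hi Hw IH]; intros x Hx.
- revert Hx. apply gram_ext. intros k Hk. unfold relabel. f_equal. symmetry.
  exact (seq_nth 0 0 Hk).
- apply (gram_ext (relabel (relabel x (eperm (nth i swaps nil))) (eword w))).
  + intros k Hk. unfold relabel. f_equal. symmetry. apply at_compose.
    now rewrite (proj2 (eword_spec w Hw)).
  + apply IH. now apply gram_swap.
Qed.

(** * Quadratic forms in vectors of polynomials *)

Definition vec := list (poly 10).

Definition psum (l : list (poly 10)) : poly 10 := fold_right (padd 10) (pzero 10) l.

Fixpoint vdot (u v : vec) : poly 10 :=
  match u, v with
  | p :: u', q :: v' => padd 10 (pmul 10 p q) (vdot u' v')
  | _, _ => pzero 10
  end.

Definition vapply (G : list vec) (v : vec) : vec := map (fun r => vdot r v) G.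

Definition combine_vec (d : nat) (l : list (Z * vec)) : vec :=
  fold_right (fun t s => zipw (padd 10) (map (pscale 10 (fst t)) (snd t)) s)
             (repeat (pzero 10) d) l.

(** The double sum of Q_ij h_i^T G h_j, with the linear combination over j formed first: the number
    of polynomial products is then linear, not quadratic, in the size of Q. *)
Definition form (G : list vec) (Q : list (list Z)) (h : list vec) : poly 10 :=
  let I := seq 0 (length Q) in
  psum (map (fun i => vdot (nth i h nil) (vapply G
         (combine_vec (length G) (map (fun j => (sym_entry Q i j, nth j h nil)) I)))) I).

Fixpoint rdot (u v : list R) : R :=
  match u, v with a :: u', b :: v' => a * b + rdot u' v' | _, _ => 0 end.

Section Forms.
Variable y : nat -> R.
Let ev : poly 10 -> R := peval y 10 0.

Lemma ev_psum l : ev (psum l) = lsum ev l.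
Proof.
unfold ev. induction l as [|p l IH]; [apply peval_zero|].
change (psum (p :: l)) with (padd 10 p (psum l)). rewrite peval_add, IH. reflexivity.
Qed.

Lemma ev_vdot u : forall v, ev (vdot u v) = rdot (map ev u) (map ev v).
Proof.
unfold ev. induction u as [|p u IH]; intros [|q v]; try apply peval_zero.
change (vdot (p :: u) (q :: v)) with (padd 10 (pmul 10 p q) (vdot u v)).
rewrite peval_add, peval_mul, IH. reflexivity.
Qed.

Lemma rdot_zipw u v w : length u = length v ->
  rdot (map ev (zipw (padd 10) u v)) w = rdot (map ev u) w + rdot (map ev v) w.
Proof.
revert v w. induction u as [|p u IH]; intros [|q v] [|r w] H; try discriminate;
  try (cbn [map rdot zipw]; ring).
injection H as H.
change (zipw (padd 10) (p :: u) (q :: v)) with (padd 10 p q :: zipw (padd 10) u v).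
cbn [map rdot]. rewrite (IH v w H). unfold ev. rewrite peval_add. ring.
Qed.

Lemma rdot_scale c u : forall w, rdot (map ev (map (pscale 10 c) u)) w = IZR c * rdot (map ev u) w.
Proof.
induction u as [|p u IH]; intros [|r w]; cbn [map rdot]; try ring.
rewrite IH. unfold ev. rewrite peval_scale. ring.
Qed.

Lemma zipw_length {A} (f : A -> A -> A) : forall u v, length u = length v ->
  length (zipw f u v) = length u.
Proof. induction u as [|a u IH]; intros [|b v] H; cbn in *; auto. Qed.

Lemma combine_vec_length d l : Forall (fun t => length (snd t) = d) l ->
  length (combine_vec d l) = d.
Proof.
induction 1 as [|t l Ht Hl IH]; [apply repeat_length|].
change (combine_vec d (t :: l)) with
  (zipw (padd 10) (map (pscale 10 (fst t)) (snd t)) (combine_vec d l)).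
rewrite zipw_length; rewrite length_map; congruence.
Qed.

Lemma rdot_combine d l w : Forall (fun t => length (snd t) = d) l ->
  rdot (map ev (combine_vec d l)) w = lsum (fun t => IZR (fst t) * rdot (map ev (snd t)) w) l.
Proof.
induction 1 as [|t l Ht Hl IH].
- change (rdot (map ev (repeat (pzero 10) d)) w = 0). revert w.
  induction d as [|d IHd]; intros [|r w]; cbn [repeat map rdot]; try easy.
  rewrite IHd. unfold ev. rewrite peval_zero. ring.
- change (combine_vec d (t :: l)) with
    (zipw (padd 10) (map (pscale 10 (fst t)) (snd t)) (combine_vec d l)).
  rewrite rdot_zipw, rdot_scale, IH; [reflexivity|].
  rewrite length_map, combine_vec_length; auto.
Qed.

(* [G] evaluates to the Gram matrix of some vectors, the k-th coordinates of which are listed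
   in the k-th element of [As]. *)
Definition gram_form (G : list vec) : Prop :=
  exists As : list (list R), forall u v, length u = length G -> length v = length G ->
    rdot u (map (fun r => rdot (map ev r) v) G) = lsum (fun A => rdot u A * rdot v A) As.

(** If [G] is the sum of A A^T over the vectors A in [As], the form is the sum over A of z^T Q z
    with z_i = <h_i, A>. *)
Lemma form_nonneg G Q L c h : gram_form G -> dominant Q L c = true ->
  length h = length Q -> Forall (fun v => length v = length G) h ->
  0 <= ev (form G Q h).
Proof.
intros [As HG] HQ Hlen Hh. unfold form. cbv zeta. rewrite ev_psum, lsum_map.
set (I := seq 0 (length Q)).
assert (Hn : forall i, In i I -> length (nth i h nil) = length G).
{ intros i Hi. apply in_seq in Hi. rewrite Forall_forall in Hh. apply Hh, nth_In. lia. }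
assert (Hl : forall i, Forall (fun t : Z * vec => length (snd t) = length G)
  (map (fun j => (sym_entry Q i j, nth j h nil)) I)).
{ intros i. apply Forall_map, Forall_forall. intros j Hj. now apply Hn. }
apply Rle_trans with (lsum (fun A => lsum (fun i => lsum (fun j =>
  IZR (sym_entry Q i j) * (rdot (map ev (nth i h nil)) A * rdot (map ev (nth j h nil)) A)) I) I) As).
- apply lsum_nonneg. intros A _.
  exact (dominant_psd Q L c HQ (fun i => rdot (map ev (nth i h nil)) A)).
- right.
  rewrite (lsum_swap (fun A i => lsum (fun j => IZR (sym_entry Q i j) *
    (rdot (map ev (nth i h nil)) A * rdot (map ev (nth j h nil)) A)) I)).
  apply lsum_ext. intros i Hi. rewrite ev_vdot. unfold vapply. rewrite map_map.
  rewrite (map_ext _ _ (fun r => ev_vdot r _)), HG.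
  + apply lsum_ext. intros A _. rewrite rdot_combine by auto.
    rewrite lsum_map, <- lsum_scal. apply lsum_ext. intros j _. cbn [fst snd].
    rewrite <- !Rmult_assoc. f_equal. apply Rmult_comm.
  + rewrite length_map. auto.
  + rewrite length_map. now apply combine_vec_length.
Qed.
End Forms.

(** * Sum-of-squares certificates *)

(* A coefficient, the index of a vector component (or the last column of a minor), and the
   variables of a monomial. *)
Definition monomial : Type := Z * nat * list nat.

Definition mon (c : Z) (e : nat) (l : list nat) : monomial := (c, e, l).

Definition pentry (i j : nat) : poly 10 :=
  pmono 10 (if Nat.eqb i j then nil else expo 10 [eidx i j]) 1.

Definition pminus (p q : poly 10) : poly 10 := padd 10 p (pscale 10 (-1) q).

Definition minor2 (i j k l : nat) : poly 10 :=
  pminus (pmul 10 (pentry i k) (pentry j l)) (pmul 10 (pentry i l) (pentry j k)).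

(* Laplace expansion along the first two rows of the minor with rows 0,1,2,3 and columns 0,1,2,n. *)
Definition minor4 (n : nat) : poly 10 :=
  let m i j := pmul 10 (minor2 0 1 i j) in
  psum [m 0 1 (minor2 2 3 2 n); m 2 0 (minor2 2 3 1 n); m 0 n (minor2 2 3 1 2);
        m 1 2 (minor2 2 3 0 n); m n 1 (minor2 2 3 0 2); m 2 n (minor2 2 3 0 1)]%nat.

Inductive metric := Scalar | Polar | Axial.

(* Squares of scalar polynomials, the same times [1 + <p_0, p_1>], and squared norms of
   combinations of the cross products of the p_i, by the Binet-Cauchy formula. *)
Definition metric_matrix (m : metric) : list vec :=
  match m with
  | Scalar => [[pmono 10 nil 1]]
  | Polar => [[padd 10 (pmono 10 nil 1) (pentry 0 1)]]
  | Axial => map (fun e => map (fun f => minor2 (fst e) (snd e) (fst f) (snd f)) edges) edges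
  end.

(* The stabiliser of the poles {0,1}, with the signs of its elements on poles and equator. *)
Definition stabiliser : list (list nat * (Z * Z)) :=
  flat_map (fun q => map (fun r => (fst q ++ fst r, (snd q, snd r)))
     [([2;3;4]%nat, 1%Z); ([3;4;2]%nat, 1%Z); ([4;2;3]%nat, 1%Z);
      ([3;2;4]%nat, (-1)%Z); ([2;4;3]%nat, (-1)%Z); ([4;3;2]%nat, (-1)%Z)])
   [([0;1]%nat, 1%Z); ([1;0]%nat, (-1)%Z)].

(** The target depends on <p_0, p_1> alone, so the stabiliser of the poles acts on the whole
    problem. Products of generators with different characters average to zero, which splits the
    semidefinite program into blocks. *)
Inductive character := Trivial | PoleSign | FullSign.

Definition sign_of (c : character) (s : Z * Z) : Z :=
  match c with Trivial => 1 | PoleSign => fst s | FullSign => fst s * snd s end%Z.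

Definition component (m : metric) (v : list nat) (e : nat) : nat * Z :=
  match m with
  | Axial => let (i, j) := nth e edges (0, 0)%nat in
             (eidx (at_ v i) (at_ v j), if Nat.ltb (at_ v i) (at_ v j) then 1%Z else (-1)%Z)
  | _ => (0%nat, 1%Z)
  end.

(* Signed orbit of a monomial in a component, listing each image once. *)
Definition orbit (m : metric) (c : character) (e : nat) (l : list nat) : list (Z * (nat * list nat)) :=
  fold_left (fun acc vs =>
    let k := component m (fst vs) e in
    let t := (fst k, expo 10 (map (at_ (eperm (fst vs))) l)) in
    if existsb (fun u => Nat.eqb (fst (snd u)) (fst t) && eqbl (snd (snd u)) (snd t)) acc then acc
    else ((snd k * sign_of c (snd vs))%Z, t) :: acc) stabiliser nil.

(** Orbit sums keep the certificates short; soundness treats a generator as an arbitrary vector of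
    polynomials. *)
Definition generator (m : metric) (c : character) (g : list monomial) : vec :=
  fold_right (fun t v =>
    fold_right (fun u v => upd (pzero 10)
        (padd 10 (pmono 10 (snd (snd u)) (fst (fst t) * fst u))) (fst (snd u)) v)
      v (orbit m c (snd (fst t)) (snd t)))
    (repeat (pzero 10) (length (metric_matrix m))) g.

Record block := Block {
  b_metric : metric;
  b_character : character;
  b_generators : list (list monomial);
  b_matrix : list (list Z);
  b_scale : Z;
  b_factor : list (list Z) }.

Definition b_vectors (b : block) : list vec :=
  map (generator (b_metric b) (b_character b)) (b_generators b).

Definition block_poly (b : block) : poly 10 :=
  form (metric_matrix (b_metric b)) (b_matrix b) (b_vectors b).

Definition block_ok (b : block) : bool :=
  dominant (b_matrix b) (b_factor b) (b_scale b)
  && Nat.eqb (length (b_generators b)) (length (b_matrix b))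
  && forallb (fun v => Nat.eqb (length v) (length (metric_matrix (b_metric b)))) (b_vectors b).

Definition minor_poly (t : monomial) : poly 10 :=
  pmul 10 (pmono 10 (expo 10 (snd t)) (fst (fst t))) (minor4 (snd (fst t))).

Definition target_poly (t : list Z) : poly 10 := map (pmono 9 nil) t.

(* [sum of squares + combination of minors - t(<p_0, p_1>)] vanishes after averaging over S_5. *)
Definition certifies (bs : list block) (ms : list monomial) (t : list Z) : bool :=
  forallb block_ok bs && forallb (fun u => Nat.ltb (snd (fst u)) 5) ms &&
  symmetric_zero (pminus (padd 10 (psum (map block_poly bs)) (psum (map minor_poly ms)))
                         (target_poly t)).

Definition horner (t : list Z) (v : R) : R := fold_right (fun c s => IZR c + v * s) 0 t.

(** * Soundness of the certificates *)

Section Soundness.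
Variables a b c y : nat -> R.
Hypothesis Hy : gram_of a b c y.
Let ev : poly 10 -> R := peval y 10 0.
Let dot i j := a i * a j + b i * b j + c i * c j.

Lemma meval_nil n : forall k, meval y n k nil = 1.
Proof. induction n as [|n IH]; intros k; cbn [meval hd tl pow]; [easy|]. rewrite IH. ring. Qed.

Lemma ev_pentry i j : (i < 5)%nat -> (j < 5)%nat -> ev (pentry i j) = dot i j.
Proof.
intros Hi Hj. destruct Hy as [H1 H2]. unfold ev, pentry. rewrite peval_mono.
destruct (Nat.eqb_spec i j) as [<-|Hij].
- rewrite meval_nil. unfold dot. rewrite H1 by easy. ring.
- rewrite meval_expo by (constructor; [apply eidx_bound | constructor]). cbn [mval].
  rewrite H2 by easy. unfold dot. ring.
Qed.

Lemma ev_pminus p q : ev (pminus p q) = ev p - ev q.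
Proof. unfold ev, pminus. rewrite peval_add, peval_scale. ring. Qed.

Lemma ev_minor2 i j k l : (i < 5)%nat -> (j < 5)%nat -> (k < 5)%nat -> (l < 5)%nat ->
  ev (minor2 i j k l) = dot i k * dot j l - dot i l * dot j k.
Proof.
intros Hi Hj Hk Hl. unfold minor2. rewrite ev_pminus. unfold ev. rewrite !peval_mul.
fold ev. now rewrite !ev_pentry.
Qed.

(** Four vectors of R^3 are linearly dependent; in coordinates this is a polynomial identity. *)
Lemma ev_minor4 n : (n < 5)%nat -> ev (minor4 n) = 0.
Proof.
intros Hn. unfold minor4. cbv zeta. unfold ev. rewrite ev_psum. unfold lsum. cbn [fold_right].
rewrite !peval_mul. fold ev. rewrite !ev_minor2 by (easy || lia). unfold dot. ring.
Qed.

Lemma rdot_comm u : forall v, rdot u v = rdot v u.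
Proof. induction u as [|r u IH]; intros [|s v]; cbn [rdot]; try easy. rewrite IH. ring. Qed.

Lemma rdot_comb {A} (f g h : A -> R) k l m E : forall u,
  rdot u (map (fun e => f e * k + g e * l + h e * m) E)
  = k * rdot u (map f E) + l * rdot u (map g E) + m * rdot u (map h E).
Proof.
induction E as [|e E IH]; intros [|r u]; cbn [map rdot]; try ring. rewrite IH. ring.
Qed.

(** 1 + <p_0, p_1> is half of |p_0 + p_1|^2. In the axial case [f1], [f2], [f3] are the coordinates
    of the cross products, whose inner products are the 2x2 minors. *)
Lemma metric_gram m : gram_form y (metric_matrix m).
Proof.
assert (H1 : forall p, 0 <= ev p -> gram_form y [[p]]).
{ intros p Hp. exists [[sqrt (ev p)]]. intros [|r u] [|s v]; try discriminate. intros _ _.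
  cbn [map rdot lsum fold_right]. fold ev.
  assert (H := sqrt_sqrt _ Hp). set (q := sqrt (ev p)) in *.
  rewrite <- H. destruct u, v; cbn [rdot]; ring. }
destruct m; cbn [metric_matrix].
- apply H1. unfold ev. rewrite peval_mono, meval_nil. lra.
- apply H1. unfold ev. rewrite peval_add, peval_mono, meval_nil. fold ev.
  rewrite ev_pentry by lia. destruct Hy as [Hu _].
  assert (H0 := Hu 0%nat ltac:(lia)). assert (H0' := Hu 1%nat ltac:(lia)). unfold dot.
  assert (0 <= (a 0%nat + a 1%nat)^2 + (b 0%nat + b 1%nat)^2 + (c 0%nat + c 1%nat)^2).
  { repeat apply Rplus_le_le_0_compat; apply pow2_ge_0. }
  lra.
- set (f1 := fun e : nat * nat => b (fst e) * c (snd e) - c (fst e) * b (snd e)).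
  set (f2 := fun e : nat * nat => c (fst e) * a (snd e) - a (fst e) * c (snd e)).
  set (f3 := fun e : nat * nat => a (fst e) * b (snd e) - b (fst e) * a (snd e)).
  exists [map f1 edges; map f2 edges; map f3 edges]. intros u v _ _.
  rewrite map_map. unfold lsum. cbn [fold_right].
  assert (Hb : Forall (fun e => (fst e < 5 /\ snd e < 5)%nat) edges)
    by (repeat constructor).
  rewrite Forall_forall in Hb.
  rewrite (map_ext_in _ (fun e => f1 e * rdot v (map f1 edges) + f2 e * rdot v (map f2 edges)
                                  + f3 e * rdot v (map f3 edges))).
  + rewrite rdot_comb. ring.
  + intros e He. rewrite map_map. rewrite rdot_comm.
    rewrite (map_ext_in _ (fun f => f1 f * f1 e + f2 f * f2 e + f3 f * f3 e)).
    * rewrite rdot_comb. ring.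
    * intros f Hf. destruct (Hb e He), (Hb f Hf). fold ev. rewrite ev_minor2 by easy.
      unfold f1, f2, f3, dot. ring.
Qed.

Lemma ev_target t : ev (target_poly t) = horner t (dot 0 1).
Proof.
destruct Hy as [_ H2]. unfold ev. induction t as [|z t IH]; [easy|].
change (peval y 9 1 (pmono 9 nil z) + y 0%nat * peval y 10 0 (target_poly t)
        = IZR z + dot 0 1 * horner t (dot 0 1)).
rewrite IH, peval_mono, meval_nil. unfold dot.
rewrite <- (H2 0%nat 1%nat) by lia. cbn [eidx]. ring.
Qed.

Lemma block_nonneg bl : block_ok bl = true -> 0 <= ev (block_poly bl).
Proof.
intros H. unfold block_ok in H. rewrite !andb_true_iff in H. destruct H as [[H1 H2] H3].
eapply form_nonneg; [apply metric_gram | exact H1 | |].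
- unfold b_vectors. rewrite length_map. now apply Nat.eqb_eq.
- apply Forall_forall. intros v Hv. rewrite forallb_forall in H3. apply Nat.eqb_eq. auto.
Qed.

Lemma certificate_pointwise bs ms t :
  forallb block_ok bs = true -> forallb (fun u => Nat.ltb (snd (fst u)) 5) ms = true ->
  ev (pminus (padd 10 (psum (map block_poly bs)) (psum (map minor_poly ms))) (target_poly t))
  >= - horner t (dot 0 1).
Proof.
intros Hb Hm. rewrite forallb_forall in Hb, Hm.
rewrite ev_pminus, ev_target. unfold ev at 1. rewrite peval_add, !ev_psum, !lsum_map.
assert (0 <= lsum (fun bl => peval y 10 0 (block_poly bl)) bs).
{ apply lsum_nonneg. intros bl Hbl. apply block_nonneg. auto. }
assert (lsum (fun u => peval y 10 0 (minor_poly u)) ms = 0).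
{ rewrite <- (lsum_0 ms). apply lsum_ext. intros u Hu.
  unfold minor_poly. rewrite peval_mul. fold ev.
  rewrite ev_minor4; [ring|]. apply Nat.ltb_lt. auto. }
lra.
Qed.
End Soundness.

(** At each relabelling the certified polynomial is at least minus the target. Its sum over S_5 is
    zero, so the sum of the targets is nonnegative. *)
Theorem certificate_sound bs ms t x : certifies bs ms t = true -> gram x ->
  0 <= lsum (fun k => horner t (x k)) (seq 0 10).
Proof.
intros H Hx. unfold certifies in H. rewrite !andb_true_iff in H. destruct H as [[H1 H2] H3].
apply (symmetric_zero_spec x) in H3. unfold symeval in H3.
assert (H4 : 0 <= lsum (fun s => horner t (x (at_ s 0))) eperms).
{ assert (lsum (fun s => - horner t (x (at_ s 0))) eperms <= 0).
  - rewrite <- H3. apply lsum_le. intros s Hs.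
    destruct (gram_relabel x s Hs Hx) as [a [b [c Hg]]].
    assert (Hp := certificate_pointwise a b c (relabel x s) Hg bs ms t H1 H2).
    cbv beta zeta in Hp. destruct Hg as [_ Hg]. rewrite <- (Hg 0%nat 1%nat) in Hp by lia.
    apply Rge_le in Hp. exact Hp.
  - replace (lsum (fun s => - horner t (x (at_ s 0))) eperms)
      with (-1 * lsum (fun s => horner t (x (at_ s 0))) eperms) in H; [lra|].
    rewrite <- lsum_scal. apply lsum_ext. intros. ring. }
(* S_5 is transitive on the ten pairs, so the first pair is sent to each of them by 120 / 10 = 12
   permutations. *)
assert (H5 : lsum (fun s => horner t (x (at_ s 0))) eperms
             = 12 * lsum (fun k => horner t (x k)) (seq 0 10)); [|lra].
rewrite <- (lsum_map (fun s => at_ s 0) (fun k => horner t (x k))).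
set (l := map (fun s => at_ s 0) eperms). vm_compute in l. subst l.
unfold lsum. cbn [fold_right seq]. ring.
Qed.

(** * Certificates for N2, N3, P4 and P5 *)

Open Scope nat_scope.

(** The generators vanish at every labelling of the bi-pyramid. The first scalar one is 1 -
    2<p_0,p_1> + 2(<p_2,p_3> + <p_2,p_4> + <p_3,p_4>); the first axial one stands for 2 p_0 x p_1 +
    (p_0 - p_1) x (p_2 + p_3 + p_4), which is zero as soon as p_0 + ... + p_4 = 0. *)
Definition n2_blocks : list block := [
Block Scalar Trivial
 [[mon 1 0 [];mon (-2) 0 [0];mon 2 0 [7]];[mon (-13) 0 [];mon (-10) 0 [0];mon 8 0 [1;1];mon 4 0 [7;
7]];[mon (-3) 0 [];mon (-3) 0 [0];mon 2 0 [1;1];mon 1 0 [0;1]];[mon 1 0 [];mon 1 0 [0];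
mon (-1) 0 [1;1];mon 2 0 [1;2]];[mon 9 0 [];mon 12 0 [0];mon (-6) 0 [1;1];mon 4 0 [7;8]]]
 [[28103646400];[-9490478400;5626240400];[-36113711000;14258249600;49216647600];[-20950253600;
11587549700;30889118800;24260806400];[-4287839600;2370366400;6320226000;4922412100;1020699600]]%Z
 4096
 [[2583];[-897;753];[-3413;558;180];[-1980;1399;23;87];[-405;286;3;-4;14]]%Z;
Block Axial PoleSign
 [[mon 2 0 [];mon 1 1 []];[mon 2 0 [0];mon 1 1 [1]];[mon 2 0 [0];mon 1 1 [0]];[mon (-2) 0 [];
mon (-4) 0 [0];mon 1 1 [2]];[mon (-3) 0 [];mon (-2) 0 [0];mon 2 1 [4]];[mon (-1) 0 [];
mon (-2) 0 [0];mon 2 1 [7]];[mon 3 0 [];mon 6 0 [0];mon 2 7 [1]];[mon 1 0 [];mon (-2) 0 [0];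
mon 2 0 [7]];[mon (-1) 0 [];mon (-2) 0 [0];mon 2 1 [5]];[mon (-1) 0 [];mon 6 0 [0];mon 2 1 [9]]]
 [[355959782734];[-109904518188;363402943320];[249242007120;46925250700;431496357000];[191289611560;
28277660000;227787254000;178126726000];[-153311844745;176003800950;-168721869200;-61143071700;
190406666000];[-75673722000;141899776400;-43322276400;-16324434000;99951952000;65162544000];
[-51057512000;-35262580000;-128527034400;-50881762400;48204960800;5939435200;45165394000];
[163209619900;179375344950;132158021050;164581945300;79314893200;63458157300;-22164728400;
298389005600];[69790616800;-205394952400;-46654759200;-35794335200;-99794228000;-78614148000;
21547351600;-106871254000;129054283200];[68988477600;18647483200;31341504600;46707902900;9177283600;
6153489200;-1631316800;80144999600;-9508504000;25900534000]]%Z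
 16
 [[149135];[-46059;143474];[104453;53974;114634];[80166;38054;33229;46398];[-64251;56044;-59833;
25535;19954];[-31714;51633;-19034;4089;3629;2886];[-21397;-22230;-40111;15389;4560;-861;1812];
[68399;100097;-37399;48208;13696;2889;810;5378];[29248;-80084;-14381;-22770;-7451;-1524;-823;596;
3454];[28912;17405;-17451;11187;6312;705;1809;1387;1873;723]]%Z].

Definition n2_minors : list monomial :=
[mon (-3720417998400) 3 [];mon 589537843200 4 []].

(** This is d (10 N2(1 + v) - 3) with v = <p_0, p_1>: the minimum 3 is shared equally among the ten
    pairs, and d = 1181325721600 is the scale of the integral certificate. The other targets are
    built in the same way. *)
Definition n2_target : list Z :=
 [2362651443200;17719885824000;11813257216000]%Z.

Lemma n2_ok : certifies n2_blocks n2_minors n2_target = true.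
Proof. vm_cast_no_check (eq_refl true). Qed.

Close Scope nat_scope.

Open Scope nat_scope.

Definition n3_blocks : list block := [
Block Scalar Trivial
 [[mon (-1) 0 [1;1];mon 1 0 [0;1];mon 6 0 [1;2]];[mon (-1) 0 [0;1];mon 2 0 [1;4]];[mon (-6) 0 [0;0];
mon 3 0 [0;1];mon 8 0 [7;8]]]
 [[250164180];[-609606480;3014528160];[9922220;-309973720;295403220]]%Z
 4194304
 [[7];[-21;10];[0;-7;3]]%Z;
Block Axial PoleSign
 [[mon 2 0 [0];mon 1 1 [1]];[mon (-1) 1 [];mon 2 0 [0];mon 1 0 [1]];[mon 2 0 [0];mon 1 1 [0]];
[mon 1 1 [];mon (-4) 0 [0];mon 1 1 [2]];[mon 3 1 [];mon (-4) 0 [0];mon 4 1 [4]];[mon (-3) 1 [];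
mon 12 0 [0];mon 4 7 [1]];[mon (-1) 1 [];mon (-4) 0 [0];mon 4 0 [7]];[mon 1 1 [];mon (-4) 0 [0];
mon 4 1 [5]];[mon 1 1 [];mon 12 0 [0];mon 4 1 [9]]]
 [[1230515172];[-2571313980;8126824370];[312326540;-2775614075;3996480620];[-769716960;1014720760;
2592667360;3738073780];[-733586045;1926257760;-653339990;2013010;580529600];[94397940;-512152200;
921298385;840634585;-199270260;272333880];[592264295;-2022969060;758502990;-201682215;-461451060;
132696900;524104560];[-170674560;68372640;-185197320;-426429360;167975640;-144006660;10162950;
213793020];[-160650000;227966515;-507613330;-510674220;156408840;-185454360;-36306900;174979980;
204411060]]%Z
 64
 [[4315];[-9310;6331];[1131;-5187;5821];[-2787;-1594;6081;3318];[-2656;848;-482;-931;419];[342;-761;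
1728;713;-151;181];[2144;-1839;-20;4;95;-80;351];[-618;-740;-1037;-983;468;-217;127;262];[-582;-293;
-1510;-266;410;-331;136;191;265]]%Z].

Definition n3_minors : list monomial :=
[mon (-8108395680) 3 [];mon 57167426400 4 []].

Definition n3_target : list Z :=
 [16845373440;210567168000;336907468800;168453734400]%Z.

Lemma n3_ok : certifies n3_blocks n3_minors n3_target = true.
Proof. vm_cast_no_check (eq_refl true). Qed.

Close Scope nat_scope.

Open Scope nat_scope.

Definition p4_blocks : list block := [
Block Scalar Trivial
 [[mon (-6) 0 [0];mon (-1) 0 [1];mon 4 0 [7]];[mon (-4) 0 [0];mon 3 0 [1];mon (-4) 0 [0;0];
mon 4 0 [1;1]];[mon 22 0 [0];mon 1 0 [1];mon 16 0 [0;0];mon 8 0 [7;7]];[mon 2 0 [0];mon 2 0 [0;0];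
mon 1 0 [0;1]];[mon 1 0 [0];mon 1 0 [0;0];mon 1 0 [1;4]];[mon (-3) 0 [0];mon (-6) 0 [0;0];
mon 4 0 [7;8]];[mon 1 0 [0];mon (-2) 0 [0;0];mon 2 0 [0;7]];[mon 12 0 [0];mon 1 0 [1];mon 12 0 [0;
0];mon 4 0 [1;9]]]
 [[3709406250000];[-3865393125000;4583947500000];[2231398125000;-2534585625000;1931675625000];
[-14058495000000;12672061875000;-6366256875000;64165954945420];[-3655778375040;2100273442800;
-4585865625000;12045677475000;26973336842400];[-1512101250000;3158038125000;-729630000000;
2061984375000;-8028714375000;6339031875000];[6078166875000;-9982912500000;5550063750000;
-8481587107450;2243783394600;-12151080945300;34628770591800];[-917296875000;1278090000000;
-1963974375000;-1103911875000;7572633750000;-665156250000;-4949938125000;3683418750000]]%Z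
 1024
 [[60163];[-62743;23214];[36220;-8728;22318];[-228198;-83695;59050;9229];[-59341;-72035;-132528;2010;
4565];[-24545;66513;33919;-2533;-1201;1806];[98661;-153298;22784;6046;2261;-1702;2460];[-14890;
13523;-56484;-941;410;-271;-271;710]]%Z;
Block Scalar PoleSign
 [[mon 1 0 [0;1]];[mon (-2) 0 [1;2];mon 1 0 [1;7]]]
 [[43268864087100];[21618385754250;10815502500000]]%Z
 4194304
 [[3211];[1605;41]]%Z;
Block Scalar FullSign
 [[mon 1 0 [1;7]];[mon 1 0 [1;5]]]
 [[38245686508500];[29142640302600;22255949324400]]%Z
 4194304
 [[3019];[2301;77]]%Z;
Block Axial PoleSign
 [[mon 2 0 [];mon 1 1 []];[mon 2 0 [0];mon 1 1 [1]];[mon 2 0 [];mon 2 0 [0];mon 1 0 [1]];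
[mon 2 0 [0];mon 1 1 [0]];[mon (-2) 0 [];mon (-4) 0 [0];mon 1 1 [2]];[mon (-3) 0 [];mon (-2) 0 [0];
mon 2 1 [4]];[mon (-1) 0 [];mon (-2) 0 [0];mon 2 1 [7]];[mon 1 0 [];mon (-2) 0 [0];mon 2 0 [7]];
[mon (-1) 0 [];mon (-2) 0 [0];mon 2 1 [5]];[mon (-1) 0 [];mon 6 0 [0];mon 2 1 [9]]]
 [[39617883199692];[-1216710000000;4606308454000];[267994686970;9976736587450;22064551585520];
[11412253196850;-10878258906150;-22524418125000;29601816050400];[29785573125000;423905625000;
2531306250000;3117448125000;25681280625000];[-262968750000;13693909375125;29528173125000;
-33706530000000;6226110000000;43160163750000];[-16256480625000;3855802500000;7716740625000;
-10662176250000;-13412829375000;8394581250000;10790381250000];[-13304087547790;-12856511250000;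
-27545760000000;33300877500000;-21747453750000;-46330576875000;1589940000000;64480308750000];
[9937620000000;3776610341875;8850092106900;-7251997500000;9496451250000;12891161250000;
-1688692500000;-17469663750000;6390388125000];[8365995000000;2808877500000;6707435625000;
-4987558125000;7566631875000;9475228125000;-1453381875000;-12760728750000;4955197500000;
3883336875000]]%Z
 4096
 [[98331];[-3021;33350];[665;73096;6480];[28335;-77069;17820;12841];[73953;9802;-22794;-13449;1924];
[-653;100189;-17587;-13687;688;1090];[-40362;24571;17715;9231;-1374;212;600];[-33032;-97110;61002;
38531;-3177;-922;840;1255];[24673;29882;-6176;-4406;453;255;20;-26;409];[20771;22444;-2601;-2345;
212;188;73;41;107;403]]%Z].

Definition p4_minors : list monomial :=
[mon (-737478213516000) 3 [];mon (-354021057561600) 4 []].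

Definition p4_target : list Z :=
 [151171891200000;1719336960000000;3321888768000000;3321888768000000;1297612800000000]%Z.

Lemma p4_ok : certifies p4_blocks p4_minors p4_target = true.
Proof. vm_cast_no_check (eq_refl true). Qed.

Close Scope nat_scope.

Open Scope nat_scope.

(** [P5] has odd degree 7, matched by squares of cubics times 1 + <p_0, p_1>. This weight vanishes
    when p_0 and p_1 are the poles, so the generators only have to vanish at the other labellings of
    the bi-pyramid. *)
Definition p5_blocks : list block := [
Block Polar Trivial
 [[mon (-6) 0 [0];mon (-1) 0 [1];mon 4 0 [7]];[mon 1 0 [0];mon 2 0 [0;0]];[mon (-2) 0 [0];
mon 3 0 [1];mon 4 0 [1;1]];[mon 14 0 [0];mon 1 0 [1];mon 8 0 [7;7]];[mon 1 0 [0];mon 1 0 [0;1]];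
[mon (-2) 0 [0];mon 1 0 [1];mon 8 0 [1;2]];[mon 1 0 [0];mon 2 0 [1;4]];[mon (-2) 0 [0];mon 1 0 [1];
mon 4 0 [1;7]];[mon 1 0 [7;8]];[mon 1 0 [0];mon 1 0 [0;7]];[mon (-2) 0 [0];mon 1 0 [1];mon 2 0 [1;
5]];[mon 6 0 [0];mon 1 0 [1];mon 4 0 [1;9]];[mon (-1) 0 [0];mon 4 0 [0;0;0]];[mon 6 0 [0];
mon (-5) 0 [1];mon 8 0 [1;1;1]];[mon (-30) 0 [0];mon (-1) 0 [1];mon 16 0 [7;7;7]];[mon (-1) 0 [0];
mon 2 0 [0;0;1]];[mon (-1) 0 [0];mon 2 0 [0;1;1]];[mon 2 0 [0];mon (-1) 0 [1];mon 8 0 [1;1;2]];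
[mon (-1) 0 [0];mon 2 0 [1;1;4]];[mon 2 0 [0];mon (-1) 0 [1];mon 8 0 [1;1;7]];[mon 2 0 [0];
mon (-1) 0 [1];mon 8 0 [1;7;7]];[mon 1 0 [7;7;8]];[mon (-1) 0 [0];mon 2 0 [0;0;7]];[mon (-1) 0 [0];
mon 1 0 [0;7;7]];[mon 6 0 [0];mon (-3) 0 [1];mon 4 0 [1;1;5]];[mon (-2) 0 [0];mon (-1) 0 [1];
mon 4 0 [1;1;9]];[mon (-14) 0 [0];mon (-1) 0 [1];mon 8 0 [1;9;9]];[mon 1 0 [0;1;2]];[mon 1 0 [1;2;
3]];[mon 1 0 [1;4;7]];[mon 1 0 [1;7;8]];[mon (-1) 0 [0];mon 4 0 [0;1;4]];[mon 2 0 [0];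
mon (-1) 0 [1];mon 16 0 [1;2;7]];[mon 1 0 [7;8;9]];[mon (-1) 0 [0];mon 1 0 [0;1;9]];[mon 1 0 [0;7;
8]];[mon 2 0 [0];mon (-1) 0 [1];mon 8 0 [1;2;6]];[mon (-1) 0 [0];mon 2 0 [1;4;9]];[mon 2 0 [0];
mon (-1) 0 [1];mon 4 0 [1;5;8]]]
 [[40839355772776138776000];[-31925597148177975119144;1713573621998432399832000];
[-9533174133474562956000;-53129447209903556562149;17124585157524972996000];[19421004415196156916000;
-19281781109621166323082;-5145822490317183312000;14154256800565237620000];[-25413324581686361628000;
120968609553167263575172;-19328345566943026020000;-22050497315715843744000;
370021230658133918381048];[-2777995661777780136000;-3481826938443447396000;2208884654814673968000;
-2135353229549678556000;-14673990003336049188000;3812155097386678680000];[757034040202131516000;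
-90718841240674266014956;-12028374050020931064000;5029424812055015460000;-12160982313814364369062;
7678078640366713920000;91440598034442784362740];[6517691328455785764000;-11255683079674918368000;
-580827660753752280000;806871839088972756000;2768903524429479888000;-471156648852685752000;
-3413727748102390488000;3127824173663929872000];[-70066216238378309259322;114289584382253752603001;
30643125390617751924000;-57487508428803861936000;-71552229470877011141063;5274081028319221932000;
-83619453244320190156068;-4405770610648827552000;544944586218195559772288];[-3749629960403069292000;
-509372719856394312181936;9161764787450886072000;-21132887483952484944000;292028620883182790634888;
-4787243335413927036000;32074452019268134994216;-4563795341667893496000;20662278600121311157828;
956239504202030777632512];[-14818696753807013056736;-127195848728551316022184;
6600137657819123748000;8356779244944983292000;3360820897653982817060;-2471903174864010492000;
6460603281011403348000;-9159639898463966472000;-92114626721638649190996;15847141498068992660160;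
82751123678373302988000];[-5822967867158284788000;-16113223791149292060000;3984825804811766640000;
-3586397500521192192000;-42493725179619842964000;3354635381214728292000;-782648184221946504000;
-1389117047506957692000;43463057833511397972000;-13589459397829435428000;-3959820636467154228000;
9428630311572833328000];[-8778794374077365616000;430337607177792278976000;-8260904731358314068000;
-3454951708622631360000;8606495721184631556000;-1046991218406462912000;-36086144563876087428000;
-3839643122907842316000;40397593421575840824000;-180586321675264698468000;-34193671437857822154000;
-1838732733734567484000;138860338464247775232000];[1425258305404029756000;-13777587856899827301000;
2666916493107629136000;920838787601047524000;-3230042634842483328000;-491349938440140120000;
-4463742436827282708000;193687610350580940000;1923809946248826372000;4777501873374829896000;
1558927511104708932000;-153433299546318660000;-2099078111604816276000;898461478220782872000];
[1676089990234453464000;-4893900904562569944000;500545932722070708000;1700180819643832944000;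
-3249711228059497212000;-208713520090818468000;599936222367734208000;-41327021615299332000;
-7804998577890850380000;-2324586133494161196000;2328472372408365612000;-476770971641870400000;
-1225386313095226524000;308697266559532884000;376836567164612544000];[5228532242247813576000;
-13313007998109193572000;-1962912917391149856000;2552389910911808352000;12354182005043598324000;
-2960850237904073328000;-8009131728665070696000;1904212660167852936000;-7234077436096003152000;
-5459120738412326040000;1057134738092073828000;-3349880325331602480000;-3593845912883131488000;
698336966333122116000;92072553977226900000;5670822234421267968000];[2526179763385512432000;
219924139925534682000;-14932990334435963592000;3513984944704402872000;6496785206259498480000;
-1407593554127152524000;9965238259966582319760;-2344650417649113816000;1854384848400929278920;
-1406177359388492064000;3655168935703916136000;290700332262752940000;3131165103988682112000;
-2274435331296999552000;-1020453264972409620000;1683097189692142488000;24632359675627798512000];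
[-197113695402524340000;389057464274401824000;484661711082060600000;-164445238281565032000;
-8010532006632293556000;991409454627077772000;1972429555033690896000;-435920020660269684000;
5738367680284010772000;2119942929779222988000;-1438319448878009940000;1563242627425299480000;
-325445967848247642000;-54562533320378424000;56223209668320420000;-1495235595190866276000;
-102827755189184784000;669639107014986504000];[-5482224887160288696000;-9186406007819535675840;
-1035052446070405092000;-4286563542644066112000;-23457190219331199672000;4304559681102274176000;
30178465967865894492000;-2136859274463104268000;26190009937741035506086;23684989124588347933180;
-13262574593635157340000;5680529077482488328000;-6918113088993133830000;-1627281688124196192000;
-413142006559063452000;-7234246790544099216000;776846680200655680000;2484730182630143580000;
20856918999077659872000];[-641964139013288256000;630811018515390372000;-222023920205511468000;
-194686706093719092000;-944962644311160024000;-72375788074768464000;-354025446178816104000;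
-70736599368267228000;364849726178813172000;-3525382865147011044000;480728517692115264000;
250253030604809760000;291581166394109724000;-177213194825664624000;-32257326914726100000;
-567108915867827652000;337912898452533624000;70069925396603352000;117113137138287972000;
280671333747635556000];[1733941724372411928000;1875617543609347032000;-585945380274083808000;
1208530531726665312000;-999882827485741320000;-5700114187233312000;919138239740654340000;
205018680353151192000;-7675462002726229668000;-7508921321484904596000;771595578135677064000;
-756114767067752928000;338721550025420892000;112672039571768820000;185386059039586284000;
954424130340669780000;-22283480012640000000;-115984080956361816000;-635767899060344952000;
-310507480975131132000;738488375210040312000];[-5358250825693823244000;27202101095754592128000;
3019445046516596148000;1333798069624007328000;-15434868901070788759980;2723354738358071532000;
12841219453430435100000;-2621135322173231820000;-2577630655944581106472;-66910830815437684416000;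
-5137127078496965244000;1165589310736021776000;37882609913138822172000;382197415368653412000;
429463939413607560000;-832009116636517248000;3479434408944804552000;-64378565433660720000;
3201402462823766931840;-1047757849702754916000;1622684844949160124000;50499166843578677664000];
[-18936055724725076388000;163607384924375913972000;-895755945411819624000;-8503244977794492552000;
28927000502273303496000;3285073598746270320000;-7300313886675717732000;-7853404026516021996000;
85323756937118736960000;126952849030357271460000;9867624880546399903168;6659312632750547088000;
-6029385074633800704000;-1551973075744335552000;-858006218177120892000;-7649609902973422560000;
920495860760424432000;3302036897905892520000;3563522712449645352000;496568013204385716000;
-4450292048707796016000;-52855597104601044864000;184001270796823353192000];
[-33062796804586848948000;-256817583345794518766336;-11386721004305390700000;
-25611656228439291120000;12039317944558281696000;11743519947907208604000;56292004739908728780000;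
-2831376772738202700000;29042691244303069834728;80069474860374602856000;16103369956703845464000;
12507365888781489792000;-73234385601004491732000;-8308141570624537092000;-6499787427688058592000;
-7732824375726339120000;34789334444805775296000;155538929239798764000;21744973455461682360000;
1877132263163206236000;-2564285867132699028000;-18827265944874652584000;-26627514162329951244000;
269843873895040684272000];[-2037638259681679644000;-188737534225415934000;2489940776511813504000;
-195952009839151104000;-11318963706214813440000;-228980265578457360000;-4240352539296996408000;
-7283594193702948000;-5339136852377552532000;-22884503191329207912000;6335984431134000720000;
786326629685033052000;-1770718021657915638000;214657001713332684000;171080462790757344000;
386393633406605088000;-4064408866161194760000;-384337743623867484000;-2270878410383839080000;
165624113958090876000;111732631721521668000;-4269183860743636296000;-661388011869449040000;
63949369691845836000;3065335326919198212000];[-10257833858491902012000;-12626248027509999428399;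
4509626668856738484000;-4084626906328234596000;-18531898815226395324000;1422289031692345476000;
-3052826654581817124000;-1554492859830622008000;21529865897512783744176;-17410436127033832344000;
6717285995622272626016;5243061787470769548000;-3573757733675058171000;-38727414920253312000;
-31079644996058076000;-1564729333461428508000;-3018581561666106348000;589568435372567508000;
1379110173304138572000;264632082753823224000;-125061336123367908000;7234968456961080000;
2378895351397110216000;4772301449587956030416;2292876104765316972000;6629435340668885316000];
[4101296541054833076000;-2322628052271907644000;-2359029390214270092000;3149061921793119552000;
-15503607784231781412000;-27750095162883720000;3439161236766388716000;-252608871945288936000;
-8040986759181711456000;-13154849486626194600000;1029120265355611572000;999809053250128044000;
876273817172197224000;-346388817994627188000;32304201806609832000;-523490104906189638202;
3513056280674876100000;49088437287559032000;409667216186520996000;343032050482294536000;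
-482423176347076536000;-610041064298751756000;943046901700930488000;4374103238867436096000;
220716755351198568000;-1195056745953165348000;2781622059398265732000];[-9459222982946758032000;
8878061069992816152000;5808662668828741788000;-11896265961262851696000;127363896945894683837296;
-4971420913582113540000;205465377789620271272;4053223912120421676000;-34595072630063844990616;
108751422332688606649088;-9745863742654351092000;-18454569250377102612000;-3924821168169158400000;
-341873548273208820000;-698707190436760692000;-4937167305193683648000;-18714420332910356736000;
-2179880954733364872000;1189443616921838520000;2185170336633650916000;-4378680743165175480000;
-17745707470846805449440;-3279412639816773504000;6293190519863012172000;-1359854699889787596000;
-10596940833137684388000;-3249808081613695008000;120537228773776526976000];[-4658374627978828020000;
-99931817861270339680104;13528010502964333102684;-14275498191127438716000;-88298273033638623159376;
11178898425495791892000;38522773405352617051624;6723023728373972052000;68313184321499755058944;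
28921841077987179268244;-55010160128933730491440;23879351703176950728000;-22389794814115734192000;
-391188560802182088000;-2768582312659256710980;7971492373346191181168;-25309610171850144797168;
-2606333202239406948000;16599415353612178122832;-5674558776100101756000;1857530759137801836000;
37566792345269160514928;-28721980378516622381168;14696755386286235222024;5755591457408209296000;
11793738635134551612000;732794309395953288000;-83082108244970620896000;470362733026795414080000];
[22524525031800443784000;110299232946369556971392;-16588192506761283012000;-5416461244276128024000;
94306420797461461554040;-7616032279867947540000;5862405806755512564000;15420229766652343512000;
-17079916428079397639592;-1588949436430120260016;-74478150930494857788000;-17586156965369507592000;
17158472839338052464000;-3123732051311180100000;-2526710746880670768000;7894262140044769632000;
-9194044159094053248000;-4763462723879866380000;2034943311525722400000;322025015955092868000;
-1589630565288553392000;-13699819149231344754960;-34041811232624610096000;-2481316671827635884000;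
-1805146993075659288000;-17674043090123216940000;1062211471925953536000;79522064960751319072320;
55600407202599718658880;166214990990827185792000];[-27020066392525049712000;86924334696384398957256;
-3618067737321442416000;-11751406469402967840000;59094174107893353314408;-12260720314839154884000;
-33680217122875643628000;-6932424773407037652000;95716354382900520965728;20430138726676679713500;
19462906668931211112000;-5418778089526585080000;13273717646775120942000;738314404898227344000;
-1568182874944101768000;7535576581524453000000;11535534620109660336000;-2246567770360906344000;
-3148276906625817120000;-332174026926849756000;899336900649850872000;-18227492788842833357296;
14084935054485207068720;9610499670124377111232;2903268929712839688000;3236721710056986228000;
-5429011061467675308000;6405344446530402943680;-77491550960890720677120;-8048673264450273079680;
126883001064338365440000];[-3123770649481916280000;-3364327461470440278000;5662750362122117880000;
-3730905868403162592000;12464366332823527452000;-2265531728106377676000;-20989015389008732604000;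
1178059384902666684000;14889301900610181924000;5967633492742058676000;191158435369146300000;
-1539556720681292544000;1836857817643075392000;1102057507594859227500;-125841178339953120000;
-679755249853724748000;-6587626200046741080000;-287599028931993768000;-4508878262263742532000;
905742923650341744000;-1096185422640224796000;-8408029657296911532000;-6750121474659485736000;
-2532291803617550832000;1689030086661650700000;564395265505431228000;-1410510222909235536000;
23286250699551522276000;-39518663015666850972000;6365237387856022632000;12436474366109187920472;
12256718122245027552000];[350184172143922908000;-420252505863382500000;-170608132598346564000;
41999584792395120000;-2144157671254244184000;-116739490928790312000;-1386033252624779880000;
216472548247362528000;422822029860411456000;-4374408283792037700000;-182874631258304568000;
304785401643313932000;380008700128269036000;-45404182202897760000;-99852035185068276000;
330003536389761432000;306644878466511552000;-165662871296541432000;-830864939521725372000;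
48955134326769132000;-85339282155978972000;-455837552182567632000;-816581308417480320000;
1887174711350188392000;356442089586186912000;44014807224109656000;406844217604348260000;
-894812160449427132000;3521582258463140916000;1392287159655607777980;-545607665587488504000;
70970496324542760000;188844455137548012000];[-15877348014342171502918;336343913003848865869014;
-22312717842618992688730;13375661026351304076000;35393948571170539267840;-27307052555262314847646;
-61920872720448316682888;-17636171122083877440000;25549112403338775108384;43085805379951641298048;
28430608593937196908536;622172651886418213310;93645885164416836605024;2009717977163724520708;
5778086391729397812000;-1190272223815486788960;4592305545295803497792;3763784621088158201488;
4173340590444802754418;1158839311907321113080;3029686971641620026000;18866162099566228624320;
-5657897501096021293664;-242721176408395529424448;-1287720415164509279206;26545918372050224134562;
-13728913554109110324000;-58346535922166676364288;-104507106229603176892608;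
-99023397206937736819684;132182253184764456571552;10916471296548777683960;-4387320058343902519080;
965502631740726480192000];[21151614422388861512020;40487303290000870380000;572210798200578768000;
8312760299360299860000;125811005553009719184000;-2067277277694920544000;-6004641259676193684000;
8309115040365660708000;-111353933686189973058948;68761886096057014962632;-9962804084814264684000;
-23330916184392001020000;6241573464681018816000;2934026578422715116000;2588093616762060792000;
11026786854649651536000;-18067630069629473784000;-2690809795383468000000;-20883602283631980536160;
-3324545441066660184000;4979855131183040592000;18704104589581301946808;-13983387553331457228000;
-97254593576483996745792;-6899882854619007264000;-10602879380561052948000;-11704903234132303800000;
21878039016618127325296;3824154851758080354960;25443484628107170062288;-38046822766557398244000;
-5180231605562558556000;-2281648732528662684000;14328062809693829586464;151119250324305226957568];
[17081750419735247004000;-798952379622441066732672;30347123261372991612000;-11894449618890249972000;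
102388272812805183685112;5206650103626972660000;52268184251830883961328;17136070540626630780000;
-125478725832101668516936;349650939439804125959244;11143334548482618768000;-16885139853477865200000;
-193754523661866038520000;5063741212106766684000;-681521295228583656000;1587541568621225580000;
-24261353740176207600000;-2644287636301496991960;11096376018828817505392;-552062712244007184000;
-257373557475134496000;-10702557264478392802336;-170915710086757613712832;200457367000864361865792;
-4699539356306621421552;-12883050324926742892978;-9086299474456222260000;129885304123941868159680;
-17011216556046926463360;64234238233545209813656;-48976962449945026432320;28709467897048196808000;
-1126748492593624692949;-347038623314757593644928;43437763375142609055848;675563161978417642985536];
[3791321396500432476000;-1542345259453302876000;-1191196292208689844000;1973052059964615432000;
9546376219959623088000;366829454210221860000;4161718435860678000000;605577444500648400000;
-23785731004425845664000;8437284842366934708000;932181874766053164000;-2509728506763037824000;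
-717628013731636128000;-155510676970497024000;192584259754526508000;-243366321106903368000;
-274525549960149444000;-177065168851294944000;-1106856344547420588000;2539282131297516000;
35823797890749132000;177825592606726284000;-745056033024480012000;-98126020490374932000;
-641389145645104956000;-2317994043435564780000;411161721440654448000;6453369983815443216000;
-5457043679323576428000;4444606259614856544000;-9103443190220089656000;-447732572998827336000;
-63759403024738080000;-17541471107849369860234;8642635228236845484000;11757151230134083620000;
1878186749270947236000];[-6413016909444410628000;-120331620570533492327820;4890828331004255640000;
-9836314457205943740000;11591100753788202245154;5672700970537905084000;16052917873302886281310;
2386051929754741116000;57689594533924432114280;86883998380835602925420;-22446615221048393364000;
7112557502033644056000;-27910776323471864196000;208732858968115152000;-1203325190379569796000;
1674448095676807836000;559985444394786960000;931673891005622160000;9160361485297090068000;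
-2057772498047100516000;894051338774709852000;18716347457826259006524;-11744725776649976646608;
22724609910927224916000;-6225320133111370764000;3536530812694191708000;-5422180538172943644000;
-23233323762620154367048;95676297300684352533760;-4709040815235139152000;-23591568159571356317812;
-11390403194309539545200;-641373785960667672000;-24886576976759515502544;29696386912117298868000;
57847364267944128108000;-1473206226434227560000;58280335402537180171240];[1229844919110327036000;
2166451338000604248000;-15639978782300136000;303110559368792472000;-1283216241256315476000;
-1062566256761297640000;-5169210037180592436000;1037688263420471652000;6969584126275578225462;
-11327856167665428996000;-1938200299305560532000;-206718511958829684000;-1679432273484777900000;
275337544055038608000;113761781328244104000;1665213423640283880000;-1073842334318550984000;
-236241655876004856000;-1967944845513432720000;-5618142814329672000;187013708086795260000;
-3193171035887996988000;1554810479004659316000;-7783820756406123264000;645487634706429768000;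
612049840438034064000;-478049088388309680000;-1927273037794362192000;-575770822884169572000;
3244461399336233604000;3722989184625529104000;742049593651488936000;67281227456878644000;
7462340486083604230006;2053862861478882828000;-7553627473676406408000;-724692672734214888000;
-401469999312299808000;1430371568228358756000]]%Z
 67108864
 [[24668647];[-19284741;158624933];[-5758539;-5691050;13770431];[11731309;-385095;-821698;8512673];
[-15350985;9497454;-23409838;-19273528;65332355];[-1678056;-531090;1469042;-1307564;-3523318;
6117559];[457288;-8466496;-16323867;6214968;-5451166;20201503;23402658];[3937029;-578712;778701;
-3964227;750287;-720140;-67587;3655693];[-42323682;5590838;17770927;-40335522;-32608859;-29946781;
-9031030;-18391517;44436182];[-2264974;-48125628;-10922487;-37102491;58211240;11758465;8699905;
-71159221;4474288;41779933];[-8951273;-13036972;-1989088;26182252;7569718;825293;-7717649;-2477767;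
-9696352;527028;8691384];[-3517379;-1941293;2038830;-1321595;-9895661;566541;-2152852;-1946157;
1330909;2704838;-1456572;757519];[-5302854;39781047;5283942;3569726;-2119600;-2277911;-4271432;
-989712;249796;-11549177;-14992510;4464914;3261065];[860931;-1189594;2754294;637498;813491;-1120576;
-380718;-616139;601366;-186061;51325;136395;-436094;434548];[1012447;-336643;825905;1645353;326957;
81760;385143;252304;30307;382816;-105647;-563091;-496256;116616;160867];[3158309;-866649;-1161516;
-35908;3259071;-4272693;-1828161;2887407;1458902;-1305699;2081385;3705188;-1417038;2695966;-592848;
567745];[1525946;206176;-15435851;2567574;-2963131;-443238;-5366365;-4674004;5054744;-5067943;
-648024;1689760;2162772;-754778;-466876;-52640;445469];[-119067;22072;483789;-76073;-1707338;
1268382;131298;-1227999;665907;665648;-379993;-1491699;-473247;-286979;302503;-103683;1106;99090];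
[-3311552;-1265567;-3027908;-3289369;-7999648;4883581;11504961;-5449553;1516211;1029083;-2036115;
-4178272;-1535883;-412709;756521;-229961;-67141;198456;381808];[-387780;12114;-397411;155794;
-404846;-386043;-293098;386427;-405058;205313;-342464;-1025403;815608;-1102274;128147;-138164;18095;
31660;-12693;94122];[1047392;303531;-70616;678998;148929;547627;6981;584528;-248190;-1028121;571867;
406540;-1964362;1775988;63523;155154;-40924;24443;36716;-145011;91690];[-3236665;2161858;2807321;
7163995;-1475857;5940504;3605686;1854268;5581706;-12259690;-18414611;8231763;-2224887;5387819;
-496809;616553;105670;-238010;62321;-395225;191272;966288];[-11438374;13978597;24456;1513280;
2333197;7739109;-5889568;-14907569;16883625;30709641;26279146;-2852080;8502224;-9265488;-1072955;
-347261;182201;-293029;-576852;899297;-1019056;-775073;1335356];[-19971669;-26553384;-31647494;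
-21565476;-15788517;14718543;-6103936;-4853323;-17777311;-17772172;11726536;2970449;10506976;
-5288645;-2074148;-467043;401709;7905;232890;160686;167992;-243723;-447862;1334740];[-1230841;
-167369;2110512;1549362;-1633223;-2026181;-307184;2430324;-3999911;983605;2672705;552010;13365;
181537;-155957;74493;-83276;-56000;14197;-3786;11825;-60169;-8145;16483;111565];[-6196271;-1939413;
1487238;1444892;-4441628;-1009999;-2033455;1954835;-1265403;3253565;-679346;-810886;-2794859;
1467400;514939;91275;-112263;74283;6894;-115096;85471;30287;-1778;-75392;36241;180029];[2477399;
83002;-1482431;1958891;-2919354;-287516;185375;-698644;-563873;-129577;114195;1274329;3574742;
-2242400;-515617;-111113;76764;-125782;-42972;189333;-118354;-15938;5199;35040;11068;-40260;88112];
[-5713868;139341;3953782;-12561806;25397525;-2671690;14608802;2764265;-9094384;-3477995;-1679297;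
-14191267;13123333;-15450044;1038349;-1859020;164645;265873;46284;1124712;-377778;-102807;-183450;
174676;31345;-230968;33885;764520];[-2813903;-9729653;9441038;-20639802;-22092036;6210802;22623063;
10677333;-4067989;26037149;-11802763;60281560;-2320343;25219725;-9016621;5367572;-859921;-3142364;
-147492;-1334601;-13471;566962;207604;-3320;437196;612264;334173;-437945;2215646];[13605998;
12015607;-7294706;-28392329;11970099;-11198721;22720772;16626783;-4398855;-2576744;-992030;5184251;
11169171;-6413612;-2238963;-85783;-154321;-673831;70846;584799;-567190;-212686;6235;110088;169916;
-189012;133504;104924;281040;578858];[-16321542;6181354;-8185892;1411722;6228023;-27950678;603358;
-13200035;722108;-10860563;15171533;-5295334;-9784226;6867489;766261;202802;-109453;528013;450947;
-628020;462328;-364520;-122800;271041;117174;-161457;-129584;67766;-240643;81771;830486];[-1886922;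
-545445;5113238;-3461578;3289810;-6156351;-2958364;-37801;-4274307;-2181083;-390427;-6623220;
1310818;-3552770;990245;-685425;24412;325108;41477;211090;64727;-45046;-160722;79930;35503;-33854;
-39557;60577;-103758;10666;29541;323144];[211530;-13762;-101847;-228443;-541228;-563608;-541567;
416401;-536365;-1922;112987;866388;702405;-196245;-198418;27803;5804;-52108;-11958;22850;-16867;
-2396;-3827;7098;11399;-3170;12289;-4843;4921;1772;-3424;-417;40040];[-9590754;30430019;-15579424;
36503439;6581945;-51169397;-3088439;-25326727;-5794951;41600582;-48843038;-30564512;-51740371;
22795935;12533750;-215645;-1072352;2899176;1246503;-2411796;2513424;575047;-915178;-847373;-28474;
1691347;-360127;504365;-607224;1062127;631944;1183218;-246722;2738452];[12776688;5356680;8175982;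
-2024802;33250957;15688497;-1691836;13254842;9162183;2930066;-6045673;2266119;-13924025;11235703;
1137248;1098235;-222242;46077;-145591;-788597;267096;299366;253854;-403310;-263248;232037;-197142;
-74588;153860;-86576;-184946;-59356;-36698;73301;642653];[10318276;-73798820;6654317;-37736644;
27757441;15428649;14190931;2320005;-25268838;-30828267;-4462439;-13861273;1545630;-3900430;1697341;
-1482882;200414;926147;586124;-68965;791601;193990;-1173170;658999;-68289;-359139;-139136;324391;
-421035;-858919;95506;179887;51610;163402;-146223;1115963];[2290158;133537;-276119;277088;2678865;
3201694;247504;467928;-1082317;-311070;-213346;-58432;1484225;-1141443;-104170;-91168;34896;-28191;
-30056;85310;-45498;8162;-1602;12337;-13846;-21471;12693;8851;273;2576;-26521;640;1756;726;10855;
15621;78652];[-3873800;-11774858;-1193841;-12527579;-678269;8951168;646626;617701;12165093;3817912;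
-8839353;8973295;-8037012;9299775;-458583;1153004;-111125;-237824;3790;-661797;133355;275960;104256;
-216252;-142490;192085;-21057;-212895;179141;-53412;-71805;-67015;2854;-17277;37852;1285;-19392;
556255];[742891;293832;415174;-439825;-141825;-2634304;-552275;2410808;1448652;1061440;1425150;
-601994;-1141255;519724;144931;50543;-28976;23678;-14677;-23319;-1583;-39601;59377;-28711;4458;
25800;-21975;-4435;5954;-23491;13824;-1732;-4885;11003;3674;-30655;-7081;-3937;77157]]%Z].

Definition p5_minors : list monomial :=
[mon 80752627599208706211840 3 [];mon 669696786228287497269456 3 [0];
mon 780005147338459276152624 3 [3];mon 1108064548872354099582720 3 [0;0];
mon 1209984587371208962368000 3 [0;1];mon (-142318030971377368458816) 3 [0;3];
mon 771782147527089178656000 3 [0;7];mon (-832680968542147819375440) 3 [0;8];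
mon (-26214747198912838586832) 3 [3;3];mon 1097740382695456924932960 3 [3;6];
mon 173589597920281188096000 3 [0;0;0];mon (-150020653979506311936000) 3 [0;0;1];
mon 171080040041307961344000 3 [0;0;3];mon 145284086381411558592000 3 [0;0;7];
mon (-69227575946572617523968) 3 [0;0;8];mon 306006483504325431168000 3 [0;1;2];
mon (-61656963052254071040000) 3 [0;1;3];mon 287895184021412043648000 3 [0;1;4];
mon 359637627207236108544000 3 [0;1;5];mon (-292421366832135154018560) 3 [0;1;6];
mon 1558170590085523444725504 3 [0;1;9];mon 334063131042030400897920 3 [0;3;3];
mon 337414850577504827424000 3 [0;3;6];mon 127897360354614318336000 3 [0;3;7];
mon (-85590989000624415129888) 3 [0;3;8];mon (-1090764104149187388432576) 3 [0;8;8];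
mon 10247848843439715162496 3 [3;3;3];mon 222598049927070118583712 3 [3;3;6];
mon 679611541825214268009216 3 [3;6;8];mon 1909621001270260414746096 4 [0];
mon (-1750918850566792986796128) 4 [2];mon (-824631207991207517457744) 4 [9];
mon 1468606488435281053344000 4 [0;0];mon (-473510606446095068428032) 4 [0;1];
mon 1013965006719880815577824 4 [0;2];mon (-681228187462955728017984) 4 [0;7];
mon (-589816749280085382744720) 4 [2;9];mon (-564693592133948045649360) 4 [9;9];
mon 184458814786071745920000 4 [0;0;0];mon (-403349628678150002112000) 4 [0;0;1];
mon 186468736296226703616000 4 [0;0;2];mon 1030798093292459736231936 4 [0;0;7];
mon 1109238155402781507840 4 [0;1;2];mon 34616002625886547134720 4 [0;1;4];
mon (-29489836708076984522496) 4 [0;1;9];mon 68924681264770598253312 4 [0;2;5];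
mon (-816709681173192343165440) 4 [0;2;6];mon (-360630560153556635621856) 4 [0;2;8];
mon (-1361788685030097194112000) 4 [0;7;9];mon 360725660009771792038368 4 [2;3;5];
mon (-840596222741384558918784) 4 [2;5;7];mon 243521705723044079232000 4 [2;5;8];
mon 232358502734850015728896 4 [9;9;9]].

Definition p5_target : list Z :=
 [80752627599208706211840;1449701933566746773422080;5269002135203395582033920;
12359851911057721975111680;18970458547115696062464000;18158659645324709068800000;
9741586821491843923968000;2221765415427964403712000]%Z.

Lemma p5_ok : certifies p5_blocks p5_minors p5_target = true.
Proof. vm_cast_no_check (eq_refl true). Qed.

Close Scope nat_scope.

(** * Hermite interpolation *)

(** [F k] plays the k-th derivative of [F 0]. All derivatives are supplied in closed form, which
    avoids iterated derivability proofs. *)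
Definition chain (F : nat -> R -> R) (hi : R) : Prop :=
  forall k y, y < hi -> derivable_pt_lim (F k) y (F (S k) y).

Fixpoint ascending (lo : R) (l : list (R * nat)) : Prop :=
  match l with
  | nil => True
  | (a, m) :: l' => lo < a /\ ascending a l'
  end.

Definition total (l : list (R * nat)) : nat := fold_right (fun t n => snd t + n)%nat 0%nat l.

Definition vanishes (F : nat -> R -> R) (hi : R) (l : list (R * nat)) : Prop :=
  Forall (fun t => fst t < hi /\ (1 <= snd t)%nat /\
                   forall k, (k < snd t)%nat -> F k (fst t) = 0) l.

(** Differentiation lowers each multiplicity by one, and Rolle adds a zero strictly between any two
    neighbouring nodes, one fewer than there are nodes: the total drops by exactly one. The clause
    on [ascending] says that no new node lies to the left of [a], so that the induction can put
    nodes in front. *)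
Lemma rolle_step F hi : chain F hi -> forall l a m,
  ascending a l -> vanishes F hi ((a, m) :: l) ->
  exists l', (forall c, c < a -> ascending c l')
    /\ vanishes (fun k => F (S k)) hi l' /\ S (total l') = total ((a, m) :: l).
Proof.
intros HF. induction l as [|[b m'] l IH]; intros a m Hasc Hv.
- inversion_clear Hv as [|? ? [H1 [H2 H3]] _]. cbn [fst snd] in *.
  destruct m as [|[|m]]; [lia| |].
  + exists nil. repeat split. constructor.
  + exists [(a, S m)]. repeat split.
    * cbn. auto.
    * constructor; [|constructor]. cbn [fst snd]. repeat split; [easy|lia|].
      intros k Hk. apply H3. lia.
- destruct Hasc as [Hab Hasc].
  inversion_clear Hv as [|? ? [H1 [H2 H3]] Hv'].
  assert (Hb : b < hi /\ F 0%nat b = 0).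
  { inversion_clear Hv' as [|? ? [H4 [H5 H6]] _]. cbn [fst snd] in *. split; [easy|]. apply H6. lia. }
  destruct Hb as [Hb Hb0]. cbn [fst snd] in *.
  destruct (IH b m' Hasc Hv') as [l' [L1 [L2 L3]]].
  destruct (MVT_cor2 (F 0%nat) (F 1%nat) a b Hab) as [c [Hc Hcab]].
  { intros c Hc. apply HF. lra. }
  assert (Hc0 : F 1%nat c = 0).
  { rewrite Hb0, (H3 0%nat) in Hc by lia. apply (Rmult_eq_reg_r (b - a)); lra. }
  assert (Hcv : vanishes (fun k => F (S k)) hi ((c, 1%nat) :: l')).
  { constructor; [|easy]. cbn [fst snd]. repeat split; [lra|lia|].
    intros k Hk. now replace k with 0%nat by lia. }
  destruct m as [|[|m]]; [lia| |].
  + exists ((c, 1%nat) :: l'). split; [|split; [easy|]].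
    * intros d Hd. split; [lra|]. apply L1. lra.
    * unfold total in *. cbn [fold_right snd] in *. lia.
  + exists ((a, S m) :: (c, 1%nat) :: l'). split; [|split].
    * intros d Hd. repeat split; try lra. apply L1. lra.
    * constructor; [|easy]. cbn [fst snd]. repeat split; [easy|lia|].
      intros k Hk. apply H3. lia.
    * unfold total in *. cbn [fold_right snd] in *. lia.
Qed.

Lemma rolle_multiplicity n : forall F hi l lo, chain F hi -> ascending lo l ->
  vanishes F hi l -> total l = S n -> exists x, x < hi /\ F n x = 0.
Proof.
induction n as [|n IH]; intros F hi l lo HF Hasc Hv Ht.
- destruct l as [|[a m] l]; [discriminate|].
  inversion_clear Hv as [|? ? [H1 [H2 H3]] _]. exists a. split; [easy|]. now apply H3.
- destruct l as [|[a m] l]; [discriminate|].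
  destruct (rolle_step F hi HF l a m (proj2 Hasc) Hv) as [l' [L1 [L2 L3]]].
  apply (IH (fun k => F (S k)) hi l' (a - 1)); auto.
  + intros k. apply HF.
  + apply L1. lra.
  + lia.
Qed.

(** * Real polynomials and the sign of the interpolation error *)

Fixpoint reval (p : list R) (y : R) : R :=
  match p with nil => 0 | a :: p' => a + y * reval p' y end.

Fixpoint rderiv_from (k : nat) (p : list R) : list R :=
  match p with nil => nil | a :: p' => INR k * a :: rderiv_from (S k) p' end.

Definition rderiv (p : list R) : list R := rderiv_from 1 (tl p).

Fixpoint rderivs (k : nat) (p : list R) : list R :=
  match k with O => p | S k' => rderivs k' (rderiv p) end.

Lemma rderivs_S k : forall p, rderivs (S k) p = rderiv (rderivs k p).
Proof.
induction k as [|k IH]; intros p; [easy|].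
change (rderivs (S (S k)) p) with (rderivs (S k) (rderiv p)). rewrite IH. reflexivity.
Qed.

Lemma rderiv_from_S p y : forall k,
  reval (rderiv_from (S k) p) y = reval (rderiv_from k p) y + reval p y.
Proof.
induction p as [|a p IH]; intros k; [cbn; ring|].
cbn [rderiv_from reval]. rewrite IH, S_INR. ring.
Qed.

Lemma reval_derivable p y : derivable_pt_lim (reval p) y (reval (rderiv p) y).
Proof.
unfold rderiv. induction p as [|a p IH]; cbn [tl].
- apply derivable_pt_lim_const.
- replace (reval (rderiv_from 1 p) y) with (0 + (1 * reval p y + y * reval (rderiv_from 1 (tl p)) y)).
  + change (reval (a :: p)) with (fct_cte a + (id * reval p))%F.
    apply derivable_pt_lim_plus; [apply derivable_pt_lim_const|].
    apply derivable_pt_lim_mult; [apply derivable_pt_lim_id|easy].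
  + destruct p as [|b p]; cbn [tl rderiv_from reval]; [ring|].
    rewrite (rderiv_from_S p y 1). cbn [INR]. ring.
Qed.

Lemma rderiv_last p : (2 <= length p)%nat ->
  last (rderiv p) 0 = INR (length p - 1) * last p 0 /\ length (rderiv p) = (length p - 1)%nat.
Proof.
assert (H : forall q k, q <> nil -> last (rderiv_from k q) 0 = INR (k + length q - 1) * last q 0
                                    /\ length (rderiv_from k q) = length q).
{ induction q as [|a q IH]; intros k Hq; [easy|]. destruct q as [|b q].
  - cbn. split; [|easy]. now replace (k + 1 - 1)%nat with k by lia.
  - destruct (IH (S k)) as [H1 H2]; [easy|].
    change (last (rderiv_from k (a :: b :: q)) 0) with (last (rderiv_from (S k) (b :: q)) 0).
    change (last (a :: b :: q) 0) with (last (b :: q) 0). split.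
    + rewrite H1. cbn [length].
      now replace (S k + S (length q) - 1)%nat with (k + S (S (length q)) - 1)%nat by lia.
    + cbn [rderiv_from length] in *. lia. }
intros Hp. destruct p as [|a p]; [cbn in Hp; lia|]. unfold rderiv. cbn [tl].
destruct p as [|b p]; [cbn in Hp; lia|].
destruct (H (b :: p) 1%nat) as [H1 H2]; [easy|]. split.
- rewrite H1. change (last (a :: b :: p) 0) with (last (b :: p) 0). cbn [length].
  now replace (1 + S (length p) - 1)%nat with (S (S (length p)) - 1)%nat by lia.
- rewrite H2. cbn. lia.
Qed.

Lemma rderivs_top n : forall p, length p = S n ->
  exists c, 0 < c /\ forall y, reval (rderivs n p) y = c * last p 0.
Proof.
induction n as [|n IH]; intros p Hp.
- destruct p as [|a [|]]; try discriminate. exists 1. split; [lra|]. intros y. cbn. ring.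
- destruct (rderiv_last p) as [H1 H2]; [lia|].
  destruct (IH (rderiv p)) as [c [Hc H]]; [lia|].
  exists (c * INR (S n)). split.
  + apply Rmult_lt_0_compat; [easy|]. apply lt_0_INR. lia.
  + intros y. cbn [rderivs]. rewrite H, H1. replace (length p - 1)%nat with (S n) by lia. ring.
Qed.

Fixpoint raxpy (K : R) (p q : list R) : list R :=
  match p, q with
  | _, nil => p
  | nil, b :: q' => K * b :: raxpy K nil q'
  | a :: p', b :: q' => a + K * b :: raxpy K p' q'
  end.

Lemma raxpy_eval K y q : forall p, reval (raxpy K p q) y = reval p y + K * reval q y.
Proof.
induction q as [|b q IH]; intros [|a p]; cbn [raxpy reval]; try rewrite IH; cbn [reval]; ring.
Qed.

Lemma raxpy_rderiv_from K q : forall k p,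
  rderiv_from k (raxpy K p q) = raxpy K (rderiv_from k p) (rderiv_from k q).
Proof.
induction q as [|b q IH]; intros k [|a p]; cbn [raxpy rderiv_from]; try easy;
  rewrite IH; cbn [rderiv_from]; f_equal; ring.
Qed.

Lemma raxpy_rderivs K k : forall p q, rderivs k (raxpy K p q) = raxpy K (rderivs k p) (rderivs k q).
Proof.
induction k as [|k IH]; intros p q; [easy|].
cbn [rderivs]. rewrite <- IH. f_equal. unfold rderiv.
rewrite <- raxpy_rderiv_from. f_equal.
destruct p as [|a [|a2 p]], q as [|b q]; reflexivity.
Qed.

Lemma raxpy_last K q : forall p, (length p < length q)%nat ->
  length (raxpy K p q) = length q /\ last (raxpy K p q) 0 = K * last q 0.
Proof.
induction q as [|b q IH]; intros p Hp; [cbn in Hp; lia|].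
assert (H : length (raxpy K (tl p) q) = length q /\
            (q <> nil -> last (raxpy K (tl p) q) 0 = K * last q 0)).
{ destruct q as [|b' q].
  - destruct p as [|a p]; cbn in *; [|lia]. split; [easy|congruence].
  - destruct (IH (tl p)) as [H1 H2]; [destruct p; cbn in *; lia|]. auto. }
destruct H as [H1 H2].
assert (Hr : exists h, raxpy K p (b :: q) = h :: raxpy K (tl p) q /\ (p = nil -> h = K * b)).
{ destruct p as [|a p]; cbn [raxpy tl]; eexists; split; try reflexivity; easy. }
destruct Hr as [h [-> Hh]]. split; [cbn; now rewrite H1|].
destruct q as [|b' q].
- destruct p as [|a p]; [|cbn in Hp; lia]. cbn. auto.
- change (last (b :: b' :: q) 0) with (last (b' :: q) 0). rewrite <- H2 by easy.
  destruct (raxpy K (tl p) (b' :: q)); [discriminate|easy].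
Qed.

Fixpoint insert_node (y : R) (l : list (R * nat)) : list (R * nat) :=
  match l with
  | nil => [(y, 1%nat)]
  | (a, m) :: l' => if Rlt_dec y a then (y, 1%nat) :: l else (a, m) :: insert_node y l'
  end.

Lemma insert_node_spec y l : forall lo, lo < y -> ascending lo l ->
  (forall m, ~ In (y, m) l) ->
  ascending lo (insert_node y l) /\ total (insert_node y l) = S (total l) /\
  forall t, In t (insert_node y l) -> t = (y, 1%nat) \/ In t l.
Proof.
induction l as [|[a m] l IH]; intros lo Hlo Hasc Hn; cbn [insert_node].
- repeat split; [easy|]. intros t [<-|[]]. now left.
- destruct Hasc as [H1 H2]. destruct (Rlt_dec y a) as [Hy|Hy].
  + repeat split; try easy. intros t [<-|Ht]; auto.
  + assert (a < y).
    { destruct (Rtotal_order a y) as [|[->|]]; [easy| |lra]. exfalso. apply (Hn m). now left. }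
    destruct (IH a H H2) as [I1 [I2 I3]].
    { intros m' Hm'. apply (Hn m'). now right. }
    split; [now split|]. split.
    * change (m + total (insert_node y l) = S (m + total l))%nat. lia.
    * intros t [<-|Ht]; [right; now left|]. destruct (I3 t Ht); auto. right. now right.
Qed.

Definition interpolates (F : nat -> R -> R) (P Pi : list R) (l : list (R * nat)) : Prop :=
  Forall (fun t => (1 <= snd t)%nat /\ forall k, (k < snd t)%nat ->
    F k (fst t) = reval (rderivs k P) (fst t) /\ reval (rderivs k Pi) (fst t) = 0) l.

(* Sign of the Hermite interpolation error: the (n+1)-fold zero of
   [F - P - K Pi] forces [K = F^(n) (xi) / n!]. *)
Lemma hermite_sign F hi P Pi l lo n : chain F hi -> (forall y, y < hi -> 0 < F n y) ->
  ascending lo l -> Forall (fun t => fst t < hi) l -> total l = n ->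
  length Pi = S n -> last Pi 0 = 1 -> (length P <= n)%nat -> interpolates F P Pi l ->
  forall y, lo < y -> y < hi -> reval Pi y <> 0 -> 0 < (F 0%nat y - reval P y) * reval Pi y.
Proof.
intros HF Hpos Hasc Hlt Ht HPi HPi1 HP Hint y Hlo Hy Hne.
set (K := (F 0%nat y - reval P y) / reval Pi y).
set (h := fun k x => F k x - reval (rderivs k (raxpy K P Pi)) x).
assert (Hh : forall k x, h k x = F k x - reval (rderivs k P) x - K * reval (rderivs k Pi) x).
{ intros k x. unfold h. rewrite raxpy_rderivs, raxpy_eval. ring. }
assert (Hnot : forall m, ~ In (y, m) l).
{ intros m Hm. apply Hne. unfold interpolates in Hint. rewrite Forall_forall in Hint.
  destruct (Hint _ Hm) as [H1 H2]. exact (proj2 (H2 0%nat H1)). }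
destruct (insert_node_spec y l lo Hlo Hasc Hnot) as [I1 [I2 I3]].
destruct (rolle_multiplicity n h hi (insert_node y l) lo) as [x [Hx Hx0]]; auto.
- intros k x Hx. apply derivable_pt_lim_minus; [now apply HF|].
  rewrite rderivs_S. apply reval_derivable.
- apply Forall_forall. intros t Hin. destruct (I3 t Hin) as [->|Hin'].
  + cbn [fst snd]. repeat split; [easy|lia|]. intros k Hk. replace k with 0%nat by lia.
    rewrite Hh. cbn [rderivs]. unfold K. now field.
  + unfold interpolates in Hint. rewrite Forall_forall in Hint, Hlt.
    destruct (Hint t Hin') as [H1 H2]. repeat split; auto.
    intros k Hk. rewrite Hh. destruct (H2 k Hk) as [-> ->]. ring.
- lia.
- destruct (raxpy_last K Pi P) as [R1 R2]; [lia|].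
  destruct (rderivs_top n (raxpy K P Pi)) as [c [Hc Htop]]; [lia|].
  unfold h in Hx0. rewrite Htop, R2, HPi1, Rmult_1_r in Hx0.
  assert (HK : 0 < K).
  { apply (Rmult_lt_reg_l c); [easy|]. specialize (Hpos x Hx). lra. }
  replace (F 0%nat y - reval P y) with (K * reval Pi y) by (unfold K; now field).
  rewrite Rmult_assoc. apply Rmult_lt_0_compat; [easy|].
  exact (Rsqr_pos_lt _ Hne).
Qed.

(** * Signs of exponential polynomials on [-1, 13/2] *)

Lemma Rpower_chain r : chain (fun k x => ln r ^ k * Rpower r x) 10.
Proof.
intros k x _. unfold Rpower. cbn [pow].
replace (ln r * ln r ^ k * exp (x * ln r)) with (ln r ^ k * (exp (x * ln r) * (1 * ln r))) by ring.
apply (derivable_pt_lim_scal (fun x => exp (x * ln r))).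
apply (derivable_pt_lim_comp (fun x => x * ln r) exp).
- replace (1 * ln r) with (1 * ln r + x * 0) by ring.
  apply (derivable_pt_lim_mult id (fct_cte (ln r)));
    [apply derivable_pt_lim_id | apply derivable_pt_lim_const].
- apply derivable_pt_lim_exp.
Qed.

Definition rat_list (d : Z) (p : list Z) : list R := map (fun z => IZR z / IZR d) p.

Lemma reval_rat_list d p x : reval (rat_list d p) x = horner p x / IZR d.
Proof.
unfold rat_list, horner. induction p as [|a p IH]; cbn [map reval fold_right]; [lra|].
rewrite IH. unfold Rdiv. ring.
Qed.

Lemma last_rat_list d p : last (rat_list d p) 0 = IZR (last p 0%Z) / IZR d.
Proof.
unfold rat_list. induction p as [|a p IH]; [cbn; lra|]. destruct p as [|b p]; [easy|].
exact IH.
Qed.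

Definition int_nodes (a : Z) : list (R * nat) :=
  map (fun k => (IZR (a + k), 1%nat)) [0;1;2;3;4;5;6;7]%Z.

(** With eight nodes the error is governed by the derivative (ln r)^8 r^x, which is positive for r <
    1 and r > 1 alike; only the sign of the node polynomial [Pi] is left. The numbers -4 and 10
    merely enclose the nodes. *)
Lemma Rpower_interpolation (r : R) (a d : Z) (P Pi : list Z) : 0 < r -> r <> 1 ->
  (-4 < a)%Z -> (a < 2)%Z -> (0 < d)%Z -> length P = 8%nat -> length Pi = 9%nat -> last Pi 0%Z = 1%Z ->
  (forall k, In k [0;1;2;3;4;5;6;7]%Z ->
     IZR d * powerRZ r (a + k) = horner P (IZR (a + k)) /\ horner Pi (IZR (a + k)) = 0) ->
  forall x, -4 < x < 10 -> horner Pi x <> 0 ->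
  0 < (IZR d * Rpower r x - horner P x) * horner Pi x.
Proof.
intros Hr Hr1 Ha Ha' Hd HP HPi HPi1 Hint x Hx Hne.
assert (Hln : ln r <> 0).
{ intros H. apply Hr1. apply ln_inv; [easy|lra|]. now rewrite ln_1. }
assert (Hd' : 0 < IZR d) by now apply IZR_lt.
assert (HPi' : forall y, reval (rat_list 1 Pi) y = horner Pi y).
{ intros y. rewrite reval_rat_list. field. }
assert (H := hermite_sign (fun k x => ln r ^ k * Rpower r x) 10 (rat_list d P) (rat_list 1 Pi)
               (int_nodes a) (-4) 8 (Rpower_chain r)).
assert (Hx' : 0 < (ln r ^ 0 * Rpower r x - reval (rat_list d P) x) * reval (rat_list 1 Pi) x).
{ apply H; try lra.
  - intros y _. apply Rmult_lt_0_compat; [|apply exp_pos].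
    replace (ln r ^ 8) with ((ln r ^ 4)²) by (unfold Rsqr; ring).
    apply Rsqr_pos_lt. now apply pow_nonzero.
  - unfold int_nodes. cbn [map ascending]. repeat split; apply IZR_lt; lia.
  - unfold int_nodes. repeat constructor; cbn [fst]; apply IZR_lt; lia.
  - reflexivity.
  - unfold rat_list. now rewrite length_map.
  - rewrite last_rat_list, HPi1. field.
  - unfold rat_list. rewrite length_map. lia.
  - unfold interpolates, int_nodes. apply Forall_map, Forall_forall. intros k Hk.
    cbn [fst snd]. split; [lia|]. intros j Hj. replace j with 0%nat by lia. cbn [rderivs pow].
    destruct (Hint k Hk) as [H1 H2]. rewrite HPi', reval_rat_list, <- H1. split; [|easy].
    rewrite <- powerRZ_Rpower by easy. field. lra.
  - rewrite HPi'. easy. }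
rewrite HPi', reval_rat_list in Hx'. cbn [pow] in Hx'.
replace ((IZR d * Rpower r x - horner P x) * horner Pi x)
  with (IZR d * ((1 * Rpower r x - horner P x / IZR d) * horner Pi x)) by (field; lra).
now apply Rmult_lt_0_compat.
Qed.

(** This is 7! * 3^3 * 4^5: it clears the denominators of divided differences at eight consecutive
    integers and of (3/4)^k and (3/2)^k for -3 <= k <= 5. *)
Definition common : Z := 139345920.
(* [common * r^x] for r = 3/4 and r = 3/2, interpolated at the integers -3..4 (lower) and -2..5
   (upper). *)
Definition lower34 : list Z := map (Z.mul 4) [34836480; -10021836; 1441552; -138229; 9940; -574; 28; -1]%Z.
Definition upper34 : list Z := map (Z.mul 3) [46448640; -13362432; 1922060; -184324; 13265; -763; 35; -1]%Z.
Definition lower32 : list Z := map (Z.mul 64) [2177280; 882804; 178976; 24199; 2450; 196; 14; 1]%Z.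
Definition upper32 : list Z := map (Z.mul 96) [1451520; 588552; 119308; 16114; 1645; 133; 7; 1]%Z.

(** Four nodes lie to the right of (0,1), so the node polynomial is positive there; shifting the
    nodes by one leaves five and gives the upper bound. Exactness at 0 and 1 matters, because all
    the coefficient forms vanish at t = 0 and all but [b1_form] at t = -1. *)
Lemma lower_Rpower r P : 0 < r -> r <> 1 -> length P = 8%nat ->
  (forall k, In k [0;1;2;3;4;5;6;7]%Z -> IZR common * powerRZ r (-3 + k) = horner P (IZR (-3 + k))) ->
  forall x, 0 <= x <= 1 -> horner P x <= IZR common * Rpower r x.
Proof.
intros Hr Hr1 HP Hint x Hx.
destruct (Req_dec x 0) as [->|H0].
{ specialize (Hint 3%Z ltac:(cbn; tauto)). rewrite <- (Hint : _ = horner P 0).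
  rewrite Rpower_O by easy. change (powerRZ r (-3 + 3)) with 1. lra. }
destruct (Req_dec x 1) as [->|H1].
{ specialize (Hint 4%Z ltac:(cbn; tauto)). rewrite <- (Hint : _ = horner P 1).
  rewrite Rpower_1 by easy. change (powerRZ r (-3 + 4)) with (r * 1). lra. }
set (Pi := [0; 144; -36; -196; 49; 56; -14; -4; 1]%Z).
assert (HPi : horner Pi x = (x + 3) * (x + 2) * (x + 1) * x * ((1 - x) * (2 - x) * (3 - x) * (4 - x))).
{ unfold horner, Pi. cbn [fold_right]. ring. }
assert (Hpos : 0 < horner Pi x).
{ rewrite HPi. repeat apply Rmult_lt_0_compat; lra. }
assert (H := Rpower_interpolation r (-3) common P Pi Hr Hr1 ltac:(lia) ltac:(lia) ltac:(easy) HP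
  eq_refl eq_refl).
assert (H' : 0 < (IZR common * Rpower r x - horner P x) * horner Pi x).
{ apply H; try lra. intros k Hk. split; [auto|].
  cbn in Hk. decompose [or] Hk; subst; try contradiction; unfold horner, Pi; cbn; lra. }
apply Rlt_le, Rlt_0_minus. apply (Rmult_lt_reg_r (horner Pi x)); lra.
Qed.

Lemma upper_Rpower r P : 0 < r -> r <> 1 -> length P = 8%nat ->
  (forall k, In k [0;1;2;3;4;5;6;7]%Z -> IZR common * powerRZ r (-2 + k) = horner P (IZR (-2 + k))) ->
  forall x, 0 <= x <= 1 -> IZR common * Rpower r x <= horner P x.
Proof.
intros Hr Hr1 HP Hint x Hx.
destruct (Req_dec x 0) as [->|H0].
{ specialize (Hint 2%Z ltac:(cbn; tauto)). rewrite <- (Hint : _ = horner P 0).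
  rewrite Rpower_O by easy. change (powerRZ r (-2 + 2)) with 1. lra. }
destruct (Req_dec x 1) as [->|H1].
{ specialize (Hint 3%Z ltac:(cbn; tauto)). rewrite <- (Hint : _ = horner P 1).
  rewrite Rpower_1 by easy. change (powerRZ r (-2 + 3)) with (r * 1). lra. }
set (Pi := [0; -240; 188; 252; -231; 0; 42; -12; 1]%Z).
assert (HPi : - horner Pi x = (x + 2) * (x + 1) * x * ((1 - x) * (2 - x) * (3 - x) * (4 - x) * (5 - x))).
{ unfold horner, Pi. cbn [fold_right]. ring. }
assert (Hpos : 0 < - horner Pi x).
{ rewrite HPi. repeat apply Rmult_lt_0_compat; lra. }
assert (H := Rpower_interpolation r (-2) common P Pi Hr Hr1 ltac:(lia) ltac:(lia) ltac:(easy) HP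
  eq_refl eq_refl).
assert (H' : 0 < (IZR common * Rpower r x - horner P x) * horner Pi x).
{ apply H; try lra. intros k Hk. split; [auto|].
  cbn in Hk. decompose [or] Hk; subst; try contradiction; unfold horner, Pi; cbn; lra. }
apply Rlt_le, Rlt_0_minus. apply (Rmult_lt_reg_r (- horner Pi x)); lra.
Qed.

Ltac check_nodes :=
  intros k Hk; cbn in Hk; decompose [or] Hk; subst; try contradiction;
  unfold horner, common; cbn -[Rmult Rplus Rinv Pos.to_nat];
  unfold Pos.to_nat; cbn [Pos.iter_op Nat.add pow]; field.

Lemma lower34_spec x : 0 <= x <= 1 -> horner lower34 x <= IZR common * Rpower (3/4) x.
Proof. apply lower_Rpower; [lra|lra|reflexivity|]. check_nodes. Qed.

Lemma upper34_spec x : 0 <= x <= 1 -> IZR common * Rpower (3/4) x <= horner upper34 x.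
Proof. apply upper_Rpower; [lra|lra|reflexivity|]. check_nodes. Qed.

Lemma lower32_spec x : 0 <= x <= 1 -> horner lower32 x <= IZR common * Rpower (3/2) x.
Proof. apply lower_Rpower; [lra|lra|reflexivity|]. check_nodes. Qed.

Lemma upper32_spec x : 0 <= x <= 1 -> IZR common * Rpower (3/2) x <= horner upper32 x.
Proof. apply upper_Rpower; [lra|lra|reflexivity|]. check_nodes. Qed.

(** * Positivity on [0,1] by Bernstein coefficients *)

Fixpoint binomial_power (n : nat) : poly 2 :=
  match n with
  | O => [[1%Z]]
  | S n' => pmul 2 [[0;1];[1]]%Z (binomial_power n')
  end.

(* Homogenisation of a polynomial in x by powers of [x + w]; on [0,1] take [w = 1 - x]. *)
Fixpoint homogenise (p : list Z) : poly 2 :=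
  match p with
  | nil => nil
  | c :: p' => padd 2 (pscale 2 c (binomial_power (length p))) (nil :: homogenise p')
  end.

(** Up to binomial factors, the coefficients tested are those of [p] in the Bernstein basis of
    degree [length p]. *)
Definition bernstein_nonneg (p : list Z) : bool := forallb (forallb (Z.leb 0)) (homogenise p).

Lemma peval_nonneg y (q : poly 2) : 0 <= y 0%nat -> 0 <= y 1%nat ->
  forallb (forallb (Z.leb 0)) q = true -> 0 <= peval y 2 0 q.
Proof.
intros H0 H1. induction q as [|r q IH]; [cbn; lra|].
cbn [forallb]. intros H. apply andb_true_iff in H as [Hr Hq].
change (0 <= peval y 1 1 r + y 0%nat * peval y 2 0 q).
apply Rplus_le_le_0_compat; [|apply Rmult_le_pos; auto].
clear IH Hq. induction r as [|c r IH]; [cbn; lra|].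
cbn [forallb] in Hr. apply andb_true_iff in Hr as [Hc Hr].
change (0 <= IZR c + y 1%nat * peval y 1 1 r).
apply Rplus_le_le_0_compat; [|apply Rmult_le_pos; auto].
now apply (IZR_le 0), Z.leb_le.
Qed.

Lemma bernstein_spec p x : bernstein_nonneg p = true -> 0 <= x <= 1 -> 0 <= horner p x.
Proof.
intros H Hx. set (y := fun i : nat => match i with O => x | _ => 1 - x end).
assert (Hb : forall n, peval y 2 0 (binomial_power n) = 1).
{ induction n as [|n IH]; [cbn; ring|]. cbn [binomial_power].
  rewrite peval_mul, IH. cbn. ring. }
assert (Hh : peval y 2 0 (homogenise p) = horner p x).
{ clear H. induction p as [|c p IH]; [easy|]. cbn [homogenise].
  rewrite peval_add, peval_scale, Hb.
  change (peval y 2 0 (nil :: homogenise p)) with (0 + x * peval y 2 0 (homogenise p)).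
  rewrite IH. change (horner (c :: p) x) with (IZR c + x * horner p x). ring. }
rewrite <- Hh. apply peval_nonneg; [cbn; lra|cbn; lra|exact H].
Qed.

Definition ladd : list Z -> list Z -> list Z := padd 1.
Definition lmul : list Z -> list Z -> list Z := pmul 1.
Definition lscale (c : Z) : list Z -> list Z := map (Z.mul c).

Lemma horner_peval p x : horner p x = peval (fun _ => x) 1 0 p.
Proof.
induction p as [|c p IH]; [easy|].
change (IZR c + x * horner p x = IZR c + x * peval (fun _ => x) 1 0 p). now rewrite IH.
Qed.

Lemma horner_add p q x : horner (ladd p q) x = horner p x + horner q x.
Proof. rewrite !horner_peval. apply peval_add. Qed.

Lemma horner_mul p q x : horner (lmul p q) x = horner p x * horner q x.
Proof. rewrite !horner_peval. apply peval_mul. Qed.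

Lemma horner_scale c p x : horner (lscale c p) x = IZR c * horner p x.
Proof. rewrite !horner_peval. apply (peval_scale _ 1). Qed.

Definition shift (m : Z) (p : list Z) : list Z :=
  fold_right (fun c s => ladd [c] (lmul [m; 1%Z] s)) nil p.

Lemma horner_shift m p x : horner (shift m p) x = horner p (IZR m + x).
Proof.
induction p as [|c p IH]; [easy|].
change (shift m (c :: p)) with (ladd [c] (lmul [m; 1%Z] (shift m p))).
rewrite horner_add, horner_mul, IH. unfold horner. cbn [fold_right]. ring.
Qed.

(* [2^(n-1) p (x/2)] for a list [p] of length n. *)
Fixpoint halve (p : list Z) : list Z :=
  match p with nil => nil | c :: p' => (c * 2 ^ Z.of_nat (length p'))%Z :: halve p' end.

Lemma horner_halve p x : 2 * horner (halve p) (2 * x) = 2 ^ length p * horner p x.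
Proof.
induction p as [|c p IH]; [cbn; ring|].
cbn [halve]. change (horner (?a :: ?q) ?z) with (IZR a + z * horner q z).
rewrite mult_IZR, <- pow_IZR. cbn [length pow].
replace (2 * (IZR c * 2 ^ length p + 2 * x * horner (halve p) (2 * x)))
  with (2 * IZR c * 2 ^ length p + 2 * x * (2 * horner (halve p) (2 * x))) by ring.
rewrite IH. ring.
Qed.

(* A lower bound on [0,1] for [common * p(x) r^x], given bounds for [common * r^x]. *)
Definition product_bound (lo up p : list Z) : option (list Z) :=
  if bernstein_nonneg p then Some (lmul p lo)
  else if bernstein_nonneg (lscale (-1) p) then Some (lmul p up)
  else None.

Lemma product_bound_spec lo up p q v x : product_bound lo up p = Some q -> 0 <= x <= 1 ->
  horner lo x <= v <= horner up x -> horner q x <= horner p x * v.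
Proof.
unfold product_bound. intros H Hx Hv.
destruct (bernstein_nonneg p) eqn:H1.
- injection H as <-. assert (H := bernstein_spec _ x H1 Hx).
  rewrite horner_mul. apply Rmult_le_compat_l; lra.
- destruct (bernstein_nonneg (lscale (-1) p)) eqn:H2; [|discriminate].
  injection H as <-. assert (H := bernstein_spec _ x H2 Hx).
  rewrite horner_scale in H. rewrite horner_mul.
  assert (0 <= - horner p x * (horner up x - v)) by (apply Rmult_le_pos; lra). lra.
Qed.

(* Positivity of [(3/4)^t p4(t) + p3(t) + (3/2)^t p2(t)] for [t] in [m, m+1], or in
   [m, m+1/2], where [(3/4)^m : 1 : (3/2)^m = u : v : w]. *)
Definition segment_ok (half : bool) (m u v w : Z) (p4 p3 p2 : list Z) : bool :=
  match product_bound lower34 upper34 (shift m p4), product_bound lower32 upper32 (shift m p2) with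
  | Some q4, Some q2 =>
      let s := ladd (lscale u q4) (ladd (lscale (v * common) (shift m p3)) (lscale w q2)) in
      bernstein_nonneg (if half then halve s else s)
  | _, _ => false
  end.

Definition exp_form (p4 p3 p2 : list Z) (t : R) : R :=
  horner p4 t * Rpower 4 (- t) + horner p3 t * Rpower 3 (- t) + horner p2 t * Rpower 2 (- t).

(** Taking out the factor 3^(-t) leaves only powers of 3/4 and 3/2, bases close to 1. With t = m +
    x, the powers to the exponent m are rational, and the interpolants bound those to the exponent x
    in [0,1]. *)
Lemma segment_spec half m u v w p4 p3 p2 t : segment_ok half m u v w p4 p3 p2 = true ->
  0 < IZR v -> IZR u = IZR v * Rpower (3/4) (IZR m) -> IZR w = IZR v * Rpower (3/2) (IZR m) ->
  IZR m <= t <= IZR m + (if half then /2 else 1) -> 0 <= exp_form p4 p3 p2 t.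
Proof.
intros H Hv Hu Hw Ht. unfold segment_ok in H.
destruct (product_bound lower34 upper34 (shift m p4)) as [q4|] eqn:H4; [|discriminate].
destruct (product_bound lower32 upper32 (shift m p2)) as [q2|] eqn:H2; [|discriminate].
cbv zeta in H. set (s := ladd _ _) in H.
set (x := t - IZR m). assert (Hx : 0 <= x <= 1) by (unfold x; destruct half; lra).
assert (Hs : 0 <= horner s x).
{ destruct half.
  - assert (Hh := bernstein_spec _ (2 * x) H ltac:(unfold x; lra)).
    assert (He := horner_halve s x).
    apply (Rmult_le_reg_l (2 ^ length s)); [apply pow_lt; lra|]. lra.
  - now apply bernstein_spec. }
assert (B4 := product_bound_spec _ _ _ _ _ x H4 Hx (conj (lower34_spec x Hx) (upper34_spec x Hx))).
assert (B2 := product_bound_spec _ _ _ _ _ x H2 Hx (conj (lower32_spec x Hx) (upper32_spec x Hx))).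
rewrite horner_shift in B4, B2. replace (IZR m + x) with t in B4, B2 by (unfold x; ring).
unfold s in Hs. rewrite !horner_add, !horner_scale, horner_shift, mult_IZR in Hs.
replace (IZR m + x) with t in Hs by (unfold x; ring).
assert (Hu0 : 0 < IZR u) by (rewrite Hu; apply Rmult_lt_0_compat; [easy|apply exp_pos]).
assert (Hw0 : 0 < IZR w) by (rewrite Hw; apply Rmult_lt_0_compat; [easy|apply exp_pos]).
apply (Rmult_le_compat_l (IZR u)) in B4; [|lra]. apply (Rmult_le_compat_l (IZR w)) in B2; [|lra].
assert (E : forall a, 0 < a -> Rpower a (- t) = Rpower 3 (- t) * Rpower (3 / a) t).
{ intros a Ha. unfold Rdiv. rewrite <- Rpower_mult_distr by (lra || now apply Rinv_0_lt_compat).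
  rewrite <- Rmult_assoc, <- Rpower_plus, Rplus_opp_l, Rpower_O, Rmult_1_l by lra.
  unfold Rpower. rewrite ln_Rinv by easy. f_equal. ring. }
assert (S4 : Rpower (3/4) t = Rpower (3/4) (IZR m) * Rpower (3/4) x).
{ rewrite <- Rpower_plus. f_equal. unfold x. ring. }
assert (S2 : Rpower (3/2) t = Rpower (3/2) (IZR m) * Rpower (3/2) x).
{ rewrite <- Rpower_plus. f_equal. unfold x. ring. }
assert (Hc : 0 < IZR common) by (apply IZR_lt; reflexivity).
unfold exp_form. rewrite (E 4), (E 2), S4, S2 by lra.
set (r4 := Rpower (3/4) x) in *. set (r2 := Rpower (3/2) x) in *.
set (m4 := Rpower (3/4) (IZR m)) in *. set (m2 := Rpower (3/2) (IZR m)) in *.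
assert (H3 : 0 < Rpower 3 (- t)) by apply exp_pos.
replace (horner p4 t * (Rpower 3 (- t) * (m4 * r4)) + horner p3 t * Rpower 3 (- t)
         + horner p2 t * (Rpower 3 (- t) * (m2 * r2)))
  with (Rpower 3 (- t) * (horner p4 t * (m4 * r4) + horner p3 t + horner p2 t * (m2 * r2))) by ring.
apply Rmult_le_pos; [lra|].
apply (Rmult_le_reg_l (IZR v * IZR common)); [now apply Rmult_lt_0_compat|].
rewrite Rmult_0_r. eapply Rle_trans; [exact Hs|].
eapply Rle_trans; [apply Rplus_le_compat; [exact B4|apply Rplus_le_compat; [apply Rle_refl|exact B2]]|].
right. rewrite Hu, Hw. ring.
Qed.

Lemma Rpower_IZR_nat r (n : nat) : 0 < r -> Rpower r (IZR (Z.of_nat n)) = r ^ n.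
Proof. intros Hr. rewrite <- INR_IZR_INZ. now apply Rpower_pow. Qed.

Lemma exp_form_opp p4 p3 p2 t :
  exp_form (lscale (-1) p4) (lscale (-1) p3) (lscale (-1) p2) t = - exp_form p4 p3 p2 t.
Proof. unfold exp_form. rewrite !horner_scale. ring. Qed.

(* The last segment is [-1, 0], where the sign of the Riesz potential is reversed. *)
Definition sign_ok (p4 p3 p2 : list Z) : bool :=
  forallb (fun n => segment_ok false (Z.of_nat n) (6 ^ Z.of_nat n) (8 ^ Z.of_nat n) (12 ^ Z.of_nat n)
                      p4 p3 p2) (seq 0 6)
  && segment_ok true 6 (6 ^ 6) (8 ^ 6) (12 ^ 6) p4 p3 p2
  && segment_ok false (-1) 4 3 2 (lscale (-1) p4) (lscale (-1) p3) (lscale (-1) p2).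

Lemma sign_spec p4 p3 p2 t : sign_ok p4 p3 p2 = true ->
  (0 <= t <= 13/2 -> 0 <= exp_form p4 p3 p2 t) /\ (-1 <= t <= 0 -> exp_form p4 p3 p2 t <= 0).
Proof.
intros H. unfold sign_ok in H. rewrite !andb_true_iff in H. destruct H as [[H1 H2] H3].
assert (HR : forall n, IZR (6 ^ Z.of_nat n) = IZR (8 ^ Z.of_nat n) * Rpower (3/4) (IZR (Z.of_nat n)) /\
                       IZR (12 ^ Z.of_nat n) = IZR (8 ^ Z.of_nat n) * Rpower (3/2) (IZR (Z.of_nat n)) /\
                       0 < IZR (8 ^ Z.of_nat n)).
{ intros n. rewrite !Rpower_IZR_nat, <- !pow_IZR, <- !Rpow_mult_distr by lra.
  repeat split; try (f_equal; field). apply pow_lt. lra. }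
split; intros Ht.
- destruct (Rle_dec 6 t) as [H6|H6].
  + destruct (HR 6%nat) as [E1 [E2 E3]]. eapply segment_spec; [exact H2|exact E3|exact E1|exact E2|lra].
  + rewrite forallb_forall in H1.
    assert (Hn : exists n, In n (seq 0 6) /\ INR n <= t <= INR n + 1).
    { assert (forall n, INR n <= 6 -> t < INR n -> exists k, (k < n)%nat /\ INR k <= t <= INR k + 1).
      { induction n as [|n IH]; intros Hn Hl; [cbn in Hl; lra|].
        rewrite S_INR in Hn, Hl. destruct (Rlt_dec t (INR n)) as [Hl'|Hl'].
        - destruct IH as [k [K1 K2]]; [lra|lra|]. exists k. split; [lia|lra].
        - exists n. split; [lia|lra]. }
      destruct (H 6%nat) as [k [K1 K2]]; [cbn; lra|cbn; lra|].
      exists k. split; [apply in_seq; lia|easy]. }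
    destruct Hn as [n [N1 N2]]. specialize (H1 n N1). destruct (HR n) as [E1 [E2 E3]].
    eapply segment_spec; [exact H1|exact E3|exact E1|exact E2|]. rewrite <- INR_IZR_INZ. lra.
- enough (0 <= - exp_form p4 p3 p2 t) by lra. rewrite <- exp_form_opp.
  assert (E : forall r, 0 < r -> Rpower r (IZR (-1)) = / r).
  { intros r Hr. replace (IZR (-1)) with (- (1)) by lra. now rewrite Rpower_Ropp, Rpower_1. }
  eapply segment_spec; [exact H3| | | |]; rewrite ?E; lra.
Qed.

(* The coefficients of the Hermite interpolant in the basis y, N2, N3, P4, P5, N3(y)(y-1)^2,
   y N3(y)(y-1)^2 are sign(s) times these forms at t = s/2, up to positive integer factors. *)
Definition b1_form := ([281313;17172], [14742;173924;5088;1696], [-296055;24867])%Z.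
Definition b2_form := ([743013;32886], [-185328;365704;9744;3248], [-557685;45765])%Z.
Definition b3_form := ([1037772;60102], [-235872;504136;17808;5936], [-801900;61236])%Z.
Definition b4_form := ([-12636;-648], [1296;-6608;-192;-64], [11340;-972])%Z.
Definition kappa_form := ([129600;6480], [0;70400;1920;640], [-129600;12960])%Z.
Definition q0_form := ([-104328;-4374], [0;-59168;-1920;-640], [104328;-8748])%Z.
Definition q1_form := ([-216432;-11664], [134784;-77216;1536;-736], [81648;-6480])%Z.

Definition form_ok (p : list Z * list Z * list Z) := sign_ok (fst (fst p)) (snd (fst p)) (snd p).

(** [kappa_form] is treated separately in [kappa_pos], since uniqueness requires its coefficient to
    be strictly positive. *)
Lemma forms_ok : forallb form_ok [b1_form; b2_form; b3_form; b4_form; q0_form; q1_form] = true.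
Proof. vm_compute. reflexivity. Qed.

(** * The interpolant of the Riesz potential *)

Fixpoint rising (t : R) (k : nat) : R :=
  match k with O => 1 | S k' => rising t k' * (t + INR k') end.

(** The k-th derivative of s (4 - 2y)^(-t). Here and below [s] is the sign factor and [t] half the
    Riesz exponent, and [0 < s * t] says that their signs agree. *)
Definition power_deriv (s t : R) (k : nat) (y : R) : R :=
  s * 2 ^ k * rising t k * Rpower (4 - 2 * y) (- t - INR k).

Lemma power_deriv_chain s t : chain (power_deriv s t) 2.
Proof.
intros k y Hy. unfold power_deriv. cbn [rising pow].
replace (s * (2 * 2 ^ k) * (rising t k * (t + INR k)) * Rpower (4 - 2 * y) (- t - INR (S k)))
  with (s * 2 ^ k * rising t k * ((- t - INR k) * Rpower (4 - 2 * y) (- t - INR k - 1) * (0 - 2 * 1))).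
- apply (derivable_pt_lim_scal (fun y => Rpower (4 - 2 * y) (- t - INR k))).
  apply (derivable_pt_lim_comp (fun y => 4 - 2 * y) (fun u => Rpower u (- t - INR k))).
  + apply derivable_pt_lim_minus; [apply derivable_pt_lim_const|].
    apply (derivable_pt_lim_scal id). apply derivable_pt_lim_id.
  + apply derivable_pt_lim_power. lra.
- rewrite S_INR. replace (- t - (INR k + 1)) with (- t - INR k - 1) by ring. ring.
Qed.

(** The factor t is corrected by the sign [s], and t + 1, t + 2, ... are positive because t > -1:
    all derivatives of order at least one are positive. *)
Lemma rising_pos s t k : 0 < s * t -> -1 < t -> 0 < s * rising t (S k).
Proof.
intros Hs Ht. induction k as [|k IH]; [cbn; lra|].
cbn [rising] in *. rewrite <- Rmult_assoc. apply Rmult_lt_0_compat; [exact IH|].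
rewrite S_INR. assert (H := pos_INR k). lra.
Qed.

Lemma power_deriv_pos s t k y : 0 < s * t -> -1 < t -> 0 < power_deriv s t (S k) y.
Proof.
intros Hs Ht. unfold power_deriv.
replace (s * 2 ^ S k * rising t (S k)) with (2 ^ S k * (s * rising t (S k))) by ring.
apply Rmult_lt_0_compat; [|apply exp_pos].
apply Rmult_lt_0_compat; [apply pow_lt; lra|now apply rising_pos].
Qed.

Lemma power_deriv_at s t k y u : 0 < u -> 4 - 2 * y = u ->
  power_deriv s t k y = s * 2 ^ k * rising t k * (Rpower u (- t) * / u ^ k).
Proof.
intros Hu <-. unfold power_deriv, Rminus at 2.
rewrite Rpower_plus, (Rpower_Ropp _ (INR k)), Rpower_pow by easy. reflexivity.
Qed.

Definition coefficient (s t d : R) (p : list Z * list Z * list Z) : R :=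
  s * exp_form (fst (fst p)) (snd (fst p)) (snd p) t / d.

Section Interpolant.
Variables s t : R.
Hypothesis Hst : 0 < s * t.
Hypothesis Ht : -1 < t <= 13/2.

Let b1 := coefficient s t 26325 b1_form.
Let b2 := coefficient s t 26325 b2_form.
Let b3 := coefficient s t 26325 b3_form.
Let b4 := coefficient s t 81 b4_form.
Let kap := coefficient s t 1053 kappa_form.
Let q0 := coefficient s t 1053 q0_form.
Let q1 := coefficient s t 1053 q1_form.

Lemma coefficient_nonneg d p : 0 < d ->
  form_ok p = true -> 0 <= coefficient s t d p.
Proof.
intros Hd Hp. destruct (sign_spec _ _ _ t Hp) as [H1 H2]. unfold coefficient.
apply Rmult_le_pos; [|left; now apply Rinv_0_lt_compat].
destruct (Rle_dec 0 t) as [H|H].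
- apply Rmult_le_pos; [|apply H1; lra].
  apply Rnot_lt_le. intros Hs. assert (0 <= - s * t) by (apply Rmult_le_pos; lra). lra.
- assert (Hs : s <= 0).
  { apply Rnot_lt_le. intros Hs. assert (0 <= s * - t) by (apply Rmult_le_pos; lra). lra. }
  assert (H3 : exp_form (fst (fst p)) (snd (fst p)) (snd p) t <= 0) by (apply H2; lra).
  set (e := exp_form _ _ _ _) in *. assert (0 <= - s * - e) by (apply Rmult_le_pos; lra). lra.
Qed.

(** The coefficients, in powers of y, of s 4^(-t) + b1 y + b2 N2 + b3 N3 + b4 P4 + kap P5 + (q0 + q1
    y) N3(y)(y-1)^2. *)
Definition hermite_interpolant : list R :=
  [s * Rpower 4 (- t);
   b1 - b2/2 + b3/4 - 23/200*b4 + 13/4000*kap + q0/4;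
   b2 - b3 + 22/25*b4 - 63/1000*kap - 3/2*q0 + q1/4;
   b3 - 36/25*b4 + 291/500*kap + 13/4*q0 - 3/2*q1;
   b4 - 81/40*kap - 3*q0 + 13/4*q1;
   149/40*kap + q0 - 3*q1;
   - (17/5)*kap + q1;
   13/10*kap].

Definition node_list : list (R * nat) := [(0, 2%nat); (/2, 4%nat); (1, 2%nat)].

Definition node_poly : list R := [0; 0; 1/16; -5/8; 41/16; -11/2; 13/2; -4; 1].

(** 4 - 2y is 4, 3, 2 at the nodes, so each Hermite condition is linear in 4^(-t), 3^(-t), 2^(-t)
    with coefficients polynomial in t; it holds formally, with the three powers as
    indeterminates. *)
Lemma interpolant_spec : interpolates (power_deriv s t) hermite_interpolant node_poly node_list.
Proof.
assert (E4 := fun k => power_deriv_at s t k 0 4 ltac:(lra) ltac:(lra)).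
assert (E3 := fun k => power_deriv_at s t k (/2) 3 ltac:(lra) ltac:(lra)).
assert (E2 := fun k => power_deriv_at s t k 1 2 ltac:(lra) ltac:(lra)).
repeat apply Forall_cons; [..|apply Forall_nil]; (split; [cbn; lia|]); cbn [fst snd]; intros k Hk;
  (assert (Hk' : k = 0%nat \/ k = 1%nat \/ k = 2%nat \/ k = 3%nat) by lia);
  decompose [or] Hk'; subst k; try lia; (split; [|cbn; field]);
  rewrite ?E4, ?E3, ?E2; unfold hermite_interpolant, b1, b2, b3, b4, kap, q0, q1;
  cbn -[coefficient Rmult Rplus Rpower Rinv];
  unfold coefficient, exp_form, horner; cbn [fst snd fold_right b1_form b2_form b3_form b4_form
    kappa_form q0_form q1_form]; field.
Qed.

Lemma node_poly_eval y : reval node_poly y = y^2 * (y - /2)^4 * (y - 1)^2.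
Proof. cbn. field. Qed.

(** All multiplicities are even, so the node polynomial is a square and the interpolant stays below
    on both sides of each node. *)
Lemma interpolant_error y : 0 <= y < 2 -> y <> 0 -> y <> /2 -> y <> 1 ->
  reval hermite_interpolant y < power_deriv s t 0 y.
Proof.
intros Hy H0 H1 H2.
assert (Hp : 0 < reval node_poly y).
{ rewrite node_poly_eval. replace (y^2 * (y - /2)^4 * (y - 1)^2)
    with ((y * (y - /2)^2 * (y - 1))²) by (unfold Rsqr; ring).
  apply Rsqr_pos_lt. repeat apply Rmult_integral_contrapositive_currified; try lra. }
assert (H := hermite_sign (power_deriv s t) 2 hermite_interpolant node_poly node_list (-1) 8).
apply Rlt_0_minus, (Rmult_lt_reg_r (reval node_poly y)); [easy|]. rewrite Rmult_0_l.
apply H; try lra; try reflexivity.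
- apply power_deriv_chain.
- intros x _. apply power_deriv_pos; lra.
- cbn. lra.
- repeat constructor; cbn; lra.
- apply interpolant_spec.
Qed.

(* The leading coefficient of the interpolant is a seventh divided difference of the potential. *)
Lemma kappa_pos : 0 < kap.
Proof.
destruct (rolle_multiplicity 7 (fun k y => power_deriv s t k y - reval (rderivs k hermite_interpolant) y)
            2 node_list (-1)) as [x [_ Hx]].
- intros k y Hy. apply derivable_pt_lim_minus; [now apply power_deriv_chain|].
  rewrite rderivs_S. apply reval_derivable.
- cbn. lra.
- assert (H := interpolant_spec). unfold interpolates in H. rewrite Forall_forall in H.
  apply Forall_forall. intros nd Hn. destruct (H nd Hn) as [H1 H2]. repeat split; [|easy|].
  + cbn in Hn. decompose [or] Hn; subst; cbn; try lra.
  + intros k Hk. rewrite (proj1 (H2 k Hk)). ring.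
- reflexivity.
- destruct (rderivs_top 7 hermite_interpolant eq_refl) as [c [Hc Htop]].
  rewrite Htop in Hx. assert (H := power_deriv_pos s t 6 x Hst (proj1 Ht)).
  change (last hermite_interpolant 0) with (13/10 * kap) in Hx.
  apply (Rmult_lt_reg_l (c * (13/10))); [lra|]. lra.
Qed.

End Interpolant.

Definition N2 (y : R) : R := y * (y - /2).
Definition N3 (y : R) : R := y * (y - /2)^2.
Definition P4 (y : R) : R := N3 y * (y - 1) + 9/100 * y + 19/100 * N2 y + 56/100 * N3 y.
Definition P5 (y : R) : R := N3 y * (y - 1)^2 * (1 + y/2 + 13/10 * y^2)
  + 11/1000 * y + 44/1000 * N2 y + 357/1000 * N3 y + 13/10 * (N3 y * (y - 1)).

(** Discarding (q0 + q1 y) N3(y)(y-1)^2 >= 0 from the interpolant keeps it a minorant, and contact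
    is preserved because this term vanishes at all three nodes. *)
Lemma power_minorant s t : 0 < s * t -> -1 < t <= 13/2 ->
  exists c b1 b2 b3 b4 k, 0 <= b1 /\ 0 <= b2 /\ 0 <= b3 /\ 0 <= b4 /\ 0 < k /\
  forall y, 0 <= y < 2 ->
    let h := c + b1 * y + b2 * N2 y + b3 * N3 y + b4 * P4 y + k * P5 y in
    h <= s * Rpower (4 - 2 * y) (- t) /\
    (h = s * Rpower (4 - 2 * y) (- t) <-> y = 0 \/ y = /2 \/ y = 1).
Proof.
intros Hst Ht.
assert (Hf := forms_ok). cbn [forallb] in Hf. rewrite !andb_true_iff in Hf.
destruct Hf as [F1 [F2 [F3 [F4 [F5 [F6 _]]]]]].
assert (Hn := coefficient_nonneg s t Hst Ht).
exists (s * Rpower 4 (- t)), (coefficient s t 26325 b1_form), (coefficient s t 26325 b2_form),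
  (coefficient s t 26325 b3_form), (coefficient s t 81 b4_form), (coefficient s t 1053 kappa_form).
repeat match goal with |- _ /\ _ => split end; try (apply Hn; (lra || assumption)).
{ now apply kappa_pos. }
intros y Hy h.
assert (Hg : s * Rpower (4 - 2 * y) (- t) = power_deriv s t 0 y).
{ unfold power_deriv. cbn [pow rising INR]. replace (- t - 0) with (- t) by ring. ring. }
rewrite Hg.
assert (Hh : reval (hermite_interpolant s t) y = h + N3 y * (y - 1)^2 *
  (coefficient s t 1053 q0_form + coefficient s t 1053 q1_form * y)).
{ unfold h, hermite_interpolant, N3, P4, P5, N2, N3. cbn [reval]. field. }
assert (Hnodes : y = 0 \/ y = /2 \/ y = 1 -> h = power_deriv s t 0 y).
{ intros Hnd. assert (Hi := interpolant_spec s t). unfold interpolates in Hi.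
  rewrite Forall_forall in Hi.
  assert (Hy' : exists m, In (y, m) node_list).
  { unfold node_list. destruct Hnd as [ -> | [ -> | -> ]]; eexists; cbn; eauto. }
  destruct Hy' as [m Hm]. destruct (Hi _ Hm) as [M1 M2]. destruct (M2 0%nat M1) as [M3 _].
  cbn [fst rderivs] in M3. rewrite M3, Hh. unfold N3.
  destruct Hnd as [ -> | [ -> | -> ]]; ring. }
destruct (Req_dec y 0) as [E0|E0]; [split; [apply Req_le; auto|tauto]|].
destruct (Req_dec y (/2)) as [E1|E1]; [split; [apply Req_le; auto|tauto]|].
destruct (Req_dec y 1) as [E2|E2]; [split; [apply Req_le; auto|tauto]|].
assert (Herr := interpolant_error s t Hst Ht y Hy E0 E1 E2).
assert (Hq : 0 <= N3 y * (y - 1)^2 *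
  (coefficient s t 1053 q0_form + coefficient s t 1053 q1_form * y)).
{ unfold N3. apply Rmult_le_pos;
    [apply Rmult_le_pos; [apply Rmult_le_pos; [lra|apply pow2_ge_0]|apply pow2_ge_0]|].
  apply Rplus_le_le_0_compat; [|apply Rmult_le_pos]; try lra; apply Hn; (lra || assumption). }
split; [lra|]. split; [lra|tauto].
Qed.

(** * Energy bound *)

Definition total_of (f : R -> R) (x : nat -> R) : R := lsum (fun k => f (1 + x k)) (seq 0 10).

Lemma certified_total f x bs ms d S t : certifies bs ms t = true -> gram x -> 0 < d ->
  (forall v, horner t v = d * (10 * f (1 + v) - S)) -> S <= total_of f x.
Proof.
intros Hc Hx Hd Hf. assert (H := certificate_sound _ _ _ _ Hc Hx).
rewrite (lsum_ext _ (fun k => d * (10 * f (1 + x k) - S)) _ (fun k _ => Hf (x k))), lsum_scal in H.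
apply (Rmult_le_reg_l (10 * d)); [lra|].
unfold total_of, lsum in *. cbn [seq fold_right] in *. lra.
Qed.

Ltac expand_target :=
  intros v; unfold horner, N2, N3, P4, P5, N2, N3;
  cbn [fold_right]; field.

Lemma N2_total x : gram x -> 3 <= total_of N2 x.
Proof.
intros Hx. eapply (certified_total _ _ _ _ 1181325721600); [exact n2_ok|exact Hx|lra|].
unfold n2_target. expand_target.
Qed.

Lemma N3_total x : gram x -> 3/2 <= total_of N3 x.
Proof.
intros Hx. eapply (certified_total _ _ _ _ 16845373440); [exact n3_ok|exact Hx|lra|].
unfold n3_target. expand_target.
Qed.

Lemma P4_total x : gram x -> 417/200 <= total_of P4 x.
Proof.
intros Hx. eapply (certified_total _ _ _ _ 129761280000000); [exact p4_ok|exact Hx|lra|].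
unfold p4_target. expand_target.
Qed.

Lemma P5_total x : gram x -> 3/4 <= total_of P5 x.
Proof.
intros Hx. eapply (certified_total _ _ _ _ 170905031955997261824000); [exact p5_ok|exact Hx|lra|].
unfold p5_target. expand_target.
Qed.

(* [|p_0 + ... + p_4|^2 >= 0]. *)
Lemma linear_total x : gram x -> 15/2 <= total_of (fun y => y) x.
Proof.
intros [a [b [c [H1 H2]]]]. unfold total_of, lsum. cbn [seq fold_right].
assert (E0 := H2 0%nat 1%nat ltac:(lia) ltac:(lia) ltac:(lia)).
assert (E1 := H2 0%nat 2%nat ltac:(lia) ltac:(lia) ltac:(lia)).
assert (E2 := H2 0%nat 3%nat ltac:(lia) ltac:(lia) ltac:(lia)).
assert (E3 := H2 0%nat 4%nat ltac:(lia) ltac:(lia) ltac:(lia)).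
assert (E4 := H2 1%nat 2%nat ltac:(lia) ltac:(lia) ltac:(lia)).
assert (E5 := H2 1%nat 3%nat ltac:(lia) ltac:(lia) ltac:(lia)).
assert (E6 := H2 1%nat 4%nat ltac:(lia) ltac:(lia) ltac:(lia)).
assert (E7 := H2 2%nat 3%nat ltac:(lia) ltac:(lia) ltac:(lia)).
assert (E8 := H2 2%nat 4%nat ltac:(lia) ltac:(lia) ltac:(lia)).
assert (E9 := H2 3%nat 4%nat ltac:(lia) ltac:(lia) ltac:(lia)).
cbn [eidx] in *. rewrite E0, E1, E2, E3, E4, E5, E6, E7, E8, E9.
assert (D0 := H1 0%nat ltac:(lia)). assert (D1 := H1 1%nat ltac:(lia)).
assert (D2 := H1 2%nat ltac:(lia)). assert (D3 := H1 3%nat ltac:(lia)).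
assert (D4 := H1 4%nat ltac:(lia)).
assert (Sa := pow2_ge_0 (a 0%nat + a 1%nat + a 2%nat + a 3%nat + a 4%nat)).
assert (Sb := pow2_ge_0 (b 0%nat + b 1%nat + b 2%nat + b 3%nat + b 4%nat)).
assert (Sc := pow2_ge_0 (c 0%nat + c 1%nat + c 2%nat + c 3%nat + c 4%nat)).
lra.
Qed.

Definition is_node (y : R) : Prop := y = 0 \/ y = /2 \/ y = 1.

(** The minorant meets g at the nodes, so the energy of the bi-pyramid is the same combination of
    the five minima. In case of equality only the total of [P5] is determined, its coefficient being
    the only one known to be positive. *)
Lemma potential_bound s t x : 0 < s * t -> -1 < t <= 13/2 -> gram x ->
  (forall k, (k < 10)%nat -> -1 <= x k < 1) ->
  let g y := s * Rpower (4 - 2 * y) (- t) in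
  g 0 + 3 * g (/2) + 6 * g 1 <= total_of g x /\
  (total_of g x = g 0 + 3 * g (/2) + 6 * g 1 ->
   (forall k, (k < 10)%nat -> is_node (1 + x k)) /\ total_of P5 x = 3/4).
Proof.
intros Hst Ht Hx Hxb g.
destruct (power_minorant s t Hst Ht) as [c [b1 [b2 [b3 [b4 [k [B1 [B2 [B3 [B4 [K H]]]]]]]]]]].
set (h := fun y => c + b1 * y + b2 * N2 y + b3 * N3 y + b4 * P4 y + k * P5 y).
assert (Hgh : forall y, 0 <= y < 2 -> h y <= g y /\ (h y = g y <-> is_node y)) by exact H.
clear H.
assert (Hth : total_of h x = 10 * c + b1 * total_of (fun y => y) x + b2 * total_of N2 x
  + b3 * total_of N3 x + b4 * total_of P4 x + k * total_of P5 x).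
{ unfold h, total_of, lsum. cbn [seq fold_right]. ring. }
assert (Hin : forall i, In i (seq 0 10) -> 0 <= 1 + x i < 2).
{ intros i Hi. apply in_seq in Hi. specialize (Hxb i ltac:(lia)). lra. }
assert (Hle : total_of h x <= total_of g x).
{ apply lsum_le. intros i Hi. apply Hgh. auto. }
assert (T : g 0 + 3 * g (/2) + 6 * g 1
            = 10 * c + b1 * (15/2) + b2 * 3 + b3 * (3/2) + b4 * (417/200) + k * (3/4)).
{ rewrite <- (proj2 (proj2 (Hgh 0 ltac:(lra)))) by (unfold is_node; auto).
  rewrite <- (proj2 (proj2 (Hgh (/2) ltac:(lra)))) by (unfold is_node; auto).
  rewrite <- (proj2 (proj2 (Hgh 1 ltac:(lra)))) by (unfold is_node; auto).
  unfold h, P4, P5, N2, N3. field. }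
assert (I1 := Rmult_le_compat_l _ _ _ B1 (linear_total x Hx)).
assert (I2 := Rmult_le_compat_l _ _ _ B2 (N2_total x Hx)).
assert (I3 := Rmult_le_compat_l _ _ _ B3 (N3_total x Hx)).
assert (I4 := Rmult_le_compat_l _ _ _ B4 (P4_total x Hx)).
assert (I5 := Rmult_le_compat_l _ _ _ (Rlt_le _ _ K) (P5_total x Hx)).
split; [lra|]. intros E.
assert (E5 : total_of P5 x = 3/4).
{ apply (Rmult_eq_reg_l k); lra. }
split; [|easy]. intros i Hi. apply Hgh.
- specialize (Hxb i Hi). lra.
- assert (E0 : total_of (fun y => g y - h y) x = 0).
  { replace (total_of (fun y => g y - h y) x) with (total_of g x - total_of h x); [lra|].
    unfold total_of, lsum. cbn [seq fold_right]. ring. }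
  unfold total_of in E0.
  assert (Hz : forall l f, (forall j : nat, In j l -> 0 <= f j) -> lsum f l = 0 -> In i l -> f i = 0).
  { induction l as [|j l IH]; intros f Hf Hs Hl; [easy|].
    change (f j + lsum f l = 0) in Hs.
    assert (0 <= lsum f l) by (apply lsum_nonneg; intros j' Hj'; apply Hf; now right).
    assert (0 <= f j) by (apply Hf; now left).
    destruct Hl as [<-|Hl]; [lra|]. apply IH; auto; [|lra]. intros j' Hj'. apply Hf. now right. }
  apply Hz in E0.
  + lra.
  + intros j Hj. destruct (Hgh _ (Hin j Hj)) as [? _]. lra.
  + apply in_seq. lia.
Qed.

(** * Configurations on the sphere *)

Definition dot (p q : pt) : R := px p * px q + py p * py q + pz p * pz q.

Definition edge_dot (p : nat -> pt) (k : nat) : R :=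
  let e := nth k edges (0, 0)%nat in dot (p (fst e)) (p (snd e)).

Lemma dot_comm p q : dot p q = dot q p.
Proof. unfold dot. ring. Qed.

Lemma dot_self p : on_S2 p -> dot p p = 1.
Proof. unfold on_S2, dot. intros <-. ring. Qed.

Lemma dot_ge p q : on_S2 p -> on_S2 q -> -1 <= dot p q.
Proof.
unfold on_S2, dot. intros Hp Hq.
assert (0 <= (px p + px q)^2 + (py p + py q)^2 + (pz p + pz q)^2)
  by (repeat apply Rplus_le_le_0_compat; apply pow2_ge_0).
lra.
Qed.

Lemma dist3_dot p q : on_S2 p -> on_S2 q -> dist3 p q = sqrt (2 - 2 * dot p q).
Proof. unfold on_S2, dist3, dot. intros Hp Hq. f_equal. lra. Qed.

Lemma sum_squares_eq0 a b c : a^2 + b^2 + c^2 = 0 -> a = 0 /\ b = 0 /\ c = 0.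
Proof.
intros H. assert (Ha := pow2_ge_0 a). assert (Hb := pow2_ge_0 b). assert (Hc := pow2_ge_0 c).
repeat split; apply Rsqr_0_uniq; unfold Rsqr; lra.
Qed.

Lemma dot_lt p q : on_S2 p -> on_S2 q -> p <> q -> dot p q < 1.
Proof.
intros Hp Hq Hne. assert (Hd := dot_self p Hp). assert (Hd' := dot_self q Hq).
assert (E : (px p - px q)^2 + (py p - py q)^2 + (pz p - pz q)^2 = 2 - 2 * dot p q)
  by (unfold dot in *; lra).
apply Rnot_le_lt. intros Hle. apply Hne.
assert (Ha := pow2_ge_0 (px p - px q)). assert (Hb := pow2_ge_0 (py p - py q)).
assert (Hc := pow2_ge_0 (pz p - pz q)).
destruct (sum_squares_eq0 (px p - px q) (py p - py q) (pz p - pz q)) as [H1 [H2 H3]]; [lra|].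
destruct p, q; cbn in *. f_equal; lra.
Qed.

Lemma Riesz_dot s p q : on_S2 p -> on_S2 q -> dot p q < 1 ->
  Riesz s (dist3 p q) = Rsign s * Rpower (4 - 2 * (1 + dot p q)) (- (s / 2)).
Proof.
intros Hp Hq Hlt. unfold Riesz. f_equal. rewrite dist3_dot by easy.
rewrite <- Rpower_sqrt, Rpower_mult by lra. f_equal; lra.
Qed.

Lemma energy_total s p : (forall i, (i < 5)%nat -> on_S2 (p i)) ->
  (forall k, (k < 10)%nat -> edge_dot p k < 1) ->
  energy s p = total_of (fun y => Rsign s * Rpower (4 - 2 * y) (- (s / 2))) (edge_dot p).
Proof.
intros Hp Hlt.
assert (HE : forall k, (k < 10)%nat -> let e := nth k edges (0,0)%nat in
  Riesz s (dist3 (p (fst e)) (p (snd e)))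
  = Rsign s * Rpower (4 - 2 * (1 + edge_dot p k)) (- (s / 2))).
{ intros k Hk e. apply Riesz_dot; [| |now apply Hlt];
  apply Hp; unfold e; do 10 (destruct k as [|k]; [cbn; lia|]); lia. }
unfold energy, sum_f, total_of, lsum.
cbn [sum_f_R0 Nat.add Nat.sub seq fold_right]. rewrite <- !HE by lia. cbn [nth edges fst snd]. ring.
Qed.

Lemma edge_dot_eidx p i j : (i < 5)%nat -> (j < 5)%nat -> i <> j ->
  edge_dot p (eidx i j) = dot (p i) (p j).
Proof.
intros Hi Hj Hij.
destruct i as [|[|[|[|[|]]]]], j as [|[|[|[|[|]]]]]; try lia; try reflexivity; apply dot_comm.
Qed.

Lemma gram_edge_dot p : (forall i, (i < 5)%nat -> on_S2 (p i)) -> gram (edge_dot p).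
Proof.
intros Hp. exists (fun i => px (p i)), (fun i => py (p i)), (fun i => pz (p i)). split.
- intros i Hi. exact (dot_self _ (Hp i Hi)).
- exact (edge_dot_eidx p).
Qed.

Lemma edge_dot_range p : config5 p -> forall k, (k < 10)%nat -> -1 <= edge_dot p k < 1.
Proof.
intros [Hp Hne] k Hk. unfold edge_dot. cbv zeta. set (e := nth k edges _).
assert (He : (fst e < 5 /\ snd e < 5 /\ fst e <> snd e)%nat).
{ unfold e. do 10 (destruct k as [|k]; [cbn; lia|]). lia. }
destruct He as [H1 [H2 H3]]. split; [apply dot_ge|apply dot_lt]; auto.
Qed.

Lemma tbp_on_S2 i : (i < 5)%nat -> on_S2 (tbp i).
Proof.
intros _. assert (H := sqrt_sqrt 3 ltac:(lra)).
unfold on_S2. destruct i as [|[|[|[|]]]]; cbn [tbp px py pz]; lra.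
Qed.

Lemma tbp_edge_dots : map (edge_dot tbp) (seq 0 10) = [-1; 0; 0; 0; 0; 0; 0; -/2; -/2; -/2].
Proof.
assert (H := sqrt_sqrt 3 ltac:(lra)).
unfold edge_dot, dot. cbn [map seq nth edges fst snd tbp px py pz].
repeat (apply f_equal2; [lra|]). reflexivity.
Qed.

Lemma energy_tbp s : let g y := Rsign s * Rpower (4 - 2 * y) (- (s / 2)) in
  energy s tbp = g 0 + 3 * g (/2) + 6 * g 1.
Proof.
assert (H := tbp_edge_dots). cbn [map seq] in H. injection H as H0 H1 H2 H3 H4 H5 H6 H7 H8 H9.
intros g. rewrite energy_total.
- unfold total_of, lsum. cbn [seq fold_right].
  rewrite H0, H1, H2, H3, H4, H5, H6, H7, H8, H9. fold (g (1 + -1)) (g (1 + 0)) (g (1 + -/2)).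
  replace (1 + -1) with 0 by ring. replace (1 + 0) with 1 by ring.
  replace (1 + -/2) with (/2) by field. ring.
- apply tbp_on_S2.
- intros k Hk. do 10 (destruct k as [|k]; [lra|]). lia.
Qed.

(** * Recovering the bi-pyramid from its inner products *)

Definition frame_map (u v w : pt) (a : pt) : pt :=
  mkpt (px a * px u + py a * px v + pz a * px w)
       (px a * py u + py a * py v + pz a * py w)
       (px a * pz u + py a * pz v + pz a * pz w).

Lemma frame_map_isometry u v w : dot u u = 1 -> dot v v = 1 -> dot w w = 1 ->
  dot u v = 0 -> dot u w = 0 -> dot v w = 0 -> isometry_S2 (frame_map u v w).
Proof.
intros Huu Hvv Hww Huv Huw Hvw.
assert (H : forall x y z,
  (x * px u + y * px v + z * px w)^2 + (x * py u + y * py v + z * py w)^2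
  + (x * pz u + y * pz v + z * pz w)^2 = x^2 + y^2 + z^2).
{ intros x y z. transitivity (x^2 * dot u u + y^2 * dot v v + z^2 * dot w w
    + 2 * x * y * dot u v + 2 * x * z * dot u w + 2 * y * z * dot v w).
  - unfold dot. ring.
  - rewrite Huu, Hvv, Hww, Huv, Huw, Hvw. ring. }
split.
- intros a Ha. unfold on_S2, frame_map. cbn [px py pz]. rewrite H. exact Ha.
- intros a b _ _. unfold dist3, frame_map. cbn [px py pz]. f_equal.
  rewrite <- (H (px a - px b)). ring.
Qed.

Lemma antipodal p q : on_S2 p -> on_S2 q -> dot p q = -1 ->
  px q = - px p /\ py q = - py p /\ pz q = - pz p.
Proof.
intros Hp Hq H. assert (Hd := dot_self p Hp). assert (Hd' := dot_self q Hq). unfold dot in *.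
destruct (sum_squares_eq0 (px p + px q) (py p + py q) (pz p + pz q)) as [H1 [H2 H3]]; [lra|].
repeat split; lra.
Qed.

Lemma equilateral_sum p q r : on_S2 p -> on_S2 q -> on_S2 r ->
  dot p q = -/2 -> dot p r = -/2 -> dot q r = -/2 ->
  px p + px q + px r = 0 /\ py p + py q + py r = 0 /\ pz p + pz q + pz r = 0.
Proof.
intros Hp Hq Hr H1 H2 H3. apply sum_squares_eq0.
assert (Hd := dot_self p Hp). assert (Hd' := dot_self q Hq). assert (Hd'' := dot_self r Hr).
unfold dot in *. lra.
Qed.

(* The frame (p_k, (p_l - p_m) / sqrt 3, p_i) carries the standard bi-pyramid to p. *)
Lemma bipyramid_isometric p i j k l m :
  (forall n, (n < 5)%nat -> on_S2 (p n)) ->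
  (forall n, (n < 5)%nat <-> In n [i; j; k; l; m]) ->
  dot (p i) (p j) = -1 -> dot (p i) (p k) = 0 -> dot (p i) (p l) = 0 -> dot (p i) (p m) = 0 ->
  dot (p k) (p l) = -/2 -> dot (p k) (p m) = -/2 -> dot (p l) (p m) = -/2 ->
  isometric5 p tbp.
Proof.
intros Hp Hn Hij Hik Hil Him Hkl Hkm Hlm.
assert (Hs : forall n, In n [i; j; k; l; m] -> on_S2 (p n)) by (intros n H; apply Hp, Hn, H).
assert (Hi := Hs i ltac:(cbn; tauto)). assert (Hj := Hs j ltac:(cbn; tauto)).
assert (Hk := Hs k ltac:(cbn; tauto)). assert (Hl := Hs l ltac:(cbn; tauto)).
assert (Hm := Hs m ltac:(cbn; tauto)).
destruct (antipodal _ _ Hi Hj Hij) as [A1 [A2 A3]].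
destruct (equilateral_sum _ _ _ Hk Hl Hm Hkl Hkm Hlm) as [S1 [S2 S3]].
set (c := / sqrt 3).
assert (Hc3 := sqrt_sqrt 3 ltac:(lra)). assert (Hc0 : sqrt 3 <> 0) by (intros E; rewrite E in Hc3; lra).
assert (Hc : c * c = /3) by (unfold c; rewrite <- Rinv_mult, Hc3; reflexivity).
assert (Hcs : sqrt 3 / 2 * c = /2) by (unfold c; now field).
set (v := mkpt (c * (px (p l) - px (p m))) (c * (py (p l) - py (p m))) (c * (pz (p l) - pz (p m)))).
exists (frame_map (p k) v (p i)).
assert (Hf : forall n, (n < 5)%nat -> p (nth n [i; j; k; l; m] 0%nat) = frame_map (p k) v (p i) (tbp n)).
{ assert (Heq : forall q x y z, px q = x -> py q = y -> pz q = z -> q = mkpt x y z)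
    by (intros [] ? ? ?; cbn; now intros -> -> ->).
  intros n Hlt. unfold frame_map.
  destruct n as [|[|[|[|[|]]]]]; try lia; cbn [nth tbp px py pz v]; apply Heq; try lra;
  try (rewrite <- Rmult_assoc, Hcs; lra);
  rewrite Ropp_mult_distr_l_reverse, <- Rmult_assoc, Hcs; lra. }
assert (Hex : forall n, (n < 5)%nat -> exists n', (n' < 5)%nat /\ nth n' [i; j; k; l; m] 0%nat = n).
{ intros n Hlt. apply Hn in Hlt. destruct (In_nth _ _ 0%nat Hlt) as [n' [H1 H2]]. now exists n'. }
split; [|split].
- assert (Hdk := dot_self _ Hk). assert (Hdi := dot_self _ Hi).
  assert (Hdl := dot_self _ Hl). assert (Hdm := dot_self _ Hm).
  apply frame_map_isometry; try easy.
  + replace (dot v v) with (c * c * (dot (p l) (p l) + dot (p m) (p m) - 2 * dot (p l) (p m)))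
      by (unfold dot; cbn [px py pz v]; ring).
    rewrite Hc, Hdl, Hdm, Hlm. field.
  + replace (dot (p k) v) with (c * (dot (p k) (p l) - dot (p k) (p m)))
      by (unfold dot; cbn [px py pz v]; ring).
    rewrite Hkl, Hkm. ring.
  + now rewrite dot_comm.
  + replace (dot v (p i)) with (c * (dot (p i) (p l) - dot (p i) (p m)))
      by (unfold dot; cbn [px py pz v]; ring).
    rewrite Hil, Him. ring.
- intros n Hlt. exists (nth n [i; j; k; l; m] 0%nat). split; [|now apply Hf].
  apply Hn, nth_In. exact Hlt.
- intros n Hlt. destruct (Hex n Hlt) as [n' [H1 <-]]. exists n'. split; [easy|]. now apply Hf.
Qed.

Definition node_dots (p : nat -> pt) : Prop := forall k, (k < 10)%nat -> is_node (1 + edge_dot p k).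

(* Up to the factor 4000, [P5] takes the values 0, 22, 489 at the nodes and its total
   is 3000, but 3000 - 10 * 22 is not a multiple of 489 - 22. *)
Lemma antipodal_edge_exists x : (forall k, (k < 10)%nat -> is_node (1 + x k)) ->
  total_of P5 x = 3/4 -> exists k, (k < 10)%nat /\ x k = -1.
Proof.
intros Hn Ht.
assert (Hz : forall k, (k < 10)%nat -> x k = -1 \/
          exists z : Z, 4000 * P5 (1 + x k) = IZR (22 + 467 * z)).
{ intros k Hk. destruct (Hn k Hk) as [H|[H|H]]; [left; lra|right; exists 0%Z|right; exists 1%Z];
  rewrite H; unfold P5, N2, N3;
  rewrite plus_IZR, mult_IZR; field. }
destruct (Hz 0%nat ltac:(lia)) as [?|[z0 H0]]; [now exists 0%nat; split; [lia|]|].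
destruct (Hz 1%nat ltac:(lia)) as [?|[z1 H1]]; [now exists 1%nat; split; [lia|]|].
destruct (Hz 2%nat ltac:(lia)) as [?|[z2 H2]]; [now exists 2%nat; split; [lia|]|].
destruct (Hz 3%nat ltac:(lia)) as [?|[z3 H3]]; [now exists 3%nat; split; [lia|]|].
destruct (Hz 4%nat ltac:(lia)) as [?|[z4 H4]]; [now exists 4%nat; split; [lia|]|].
destruct (Hz 5%nat ltac:(lia)) as [?|[z5 H5]]; [now exists 5%nat; split; [lia|]|].
destruct (Hz 6%nat ltac:(lia)) as [?|[z6 H6]]; [now exists 6%nat; split; [lia|]|].
destruct (Hz 7%nat ltac:(lia)) as [?|[z7 H7]]; [now exists 7%nat; split; [lia|]|].
destruct (Hz 8%nat ltac:(lia)) as [?|[z8 H8]]; [now exists 8%nat; split; [lia|]|].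
destruct (Hz 9%nat ltac:(lia)) as [?|[z9 H9]]; [now exists 9%nat; split; [lia|]|].
exfalso. clear Hz Hn. unfold total_of, lsum in Ht. cbn [seq fold_right] in Ht.
assert (E : IZR 3000 = IZR (220 + 467 * (z0 + z1 + z2 + z3 + z4 + z5 + z6 + z7 + z8 + z9))).
{ repeat rewrite ?plus_IZR, ?mult_IZR in *. lra. }
apply eq_IZR in E. lia.
Qed.

(** In units of 1/4000 the antipodal pair contributes 0 and the six pairs joining it to the other
    points 6 * 489 = 2934 of the total 3000. The remaining 66 is a sum of three numbers among 0, 22,
    489 only as 22 + 22 + 22. *)
Lemma antipodal_isometric p i j k l m : (forall n, (n < 5)%nat -> on_S2 (p n)) ->
  (forall n, (n < 5)%nat <-> In n [i; j; k; l; m]) -> NoDup [i; j; k; l; m] ->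
  node_dots p -> edge_dot p (eidx i j) = -1 ->
  (let w a b := P5 (1 + edge_dot p (eidx a b)) in
   w i j + (w i k + w i l + w i m + w j k + w j l + w j m) + (w k l + w k m + w l m) = 3/4) ->
  isometric5 p tbp.
Proof.
intros Hp Hn Hnd Hnode Hij Hw. cbv beta zeta in Hw.
assert (Hlt : (i < 5 /\ j < 5 /\ k < 5 /\ l < 5 /\ m < 5)%nat)
  by (repeat split; apply Hn; cbn; tauto).
assert (Hne : (i <> j /\ i <> k /\ i <> l /\ i <> m /\ j <> k /\ j <> l /\ j <> m
               /\ k <> l /\ k <> m /\ l <> m)%nat).
{ rewrite !NoDup_cons_iff in Hnd. cbn [In] in Hnd. repeat split; intros ->; tauto. }
clear Hnd. decompose [and] Hlt. decompose [and] Hne. clear Hlt Hne.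
assert (Hd : forall a b, (a < 5)%nat -> (b < 5)%nat -> a <> b -> is_node (1 + dot (p a) (p b))).
{ intros a b Ha Hb Hab. rewrite <- edge_dot_eidx by easy. apply Hnode, eidx_bound. }
rewrite !edge_dot_eidx in Hw by auto. rewrite edge_dot_eidx in Hij by auto.
(* The two products are opposite, while the values -1, -1/2, 0 allowed by the nodes are all
   nonpositive: both are 0. *)
assert (Hpole : forall a, (a < 5)%nat -> a <> i -> a <> j -> dot (p i) (p a) = 0 /\ dot (p j) (p a) = 0).
{ intros a Ha Hai Haj. destruct (antipodal (p i) (p j)) as [A1 [A2 A3]]; [auto|auto|easy|].
  assert (E : dot (p j) (p a) = - dot (p i) (p a)) by (unfold dot; rewrite A1, A2, A3; ring).
  assert (D1 := Hd i a ltac:(auto) Ha ltac:(auto)). assert (D2 := Hd j a ltac:(auto) Ha ltac:(auto)).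
  unfold is_node in D1, D2. lra. }
destruct (Hpole k) as [Ik Jk]; [auto..|].
destruct (Hpole l) as [Il Jl]; [auto..|].
destruct (Hpole m) as [Im Jm]; [auto..|].
assert (Dkl := Hd k l ltac:(auto) ltac:(auto) ltac:(auto)).
assert (Dkm := Hd k m ltac:(auto) ltac:(auto) ltac:(auto)).
assert (Dlm := Hd l m ltac:(auto) ltac:(auto) ltac:(auto)).
rewrite Hij, Ik, Il, Im, Jk, Jl, Jm in Hw.
assert (V : P5 0 = 0 /\ P5 (/2) = 22/4000 /\ P5 1 = 489/4000
            /\ P5 (1 + -1) = 0 /\ P5 (1 + 0) = 489/4000).
{ unfold P5, N2, N3. repeat split; field. }
destruct V as [V0 [V1 [V2 [V3 V4]]]].
assert (Hx : dot (p k) (p l) = -/2 /\ dot (p k) (p m) = -/2 /\ dot (p l) (p m) = -/2).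
{ destruct Dkl as [E1|[E1|E1]], Dkm as [E2|[E2|E2]], Dlm as [E3|[E3|E3]];
  rewrite E1, E2, E3, ?V0, ?V1, ?V2, ?V3, ?V4 in Hw; lra. }
destruct Hx as [X1 [X2 X3]].
now apply (bipyramid_isometric p i j k l m).
Qed.

Lemma nodes_isometric p : (forall n, (n < 5)%nat -> on_S2 (p n)) -> node_dots p ->
  total_of P5 (edge_dot p) = 3/4 -> isometric5 p tbp.
Proof.
intros Hp Hn Ht. destruct (antipodal_edge_exists _ Hn Ht) as [e [He E]].
unfold total_of, lsum in Ht. cbn [seq fold_right] in Ht.
destruct e as [|[|[|[|[|[|[|[|[|[|e]]]]]]]]]]; [
  apply (antipodal_isometric p 0 1 2 3 4)|apply (antipodal_isometric p 0 2 1 3 4)|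
  apply (antipodal_isometric p 0 3 1 2 4)|apply (antipodal_isometric p 0 4 1 2 3)|
  apply (antipodal_isometric p 1 2 0 3 4)|apply (antipodal_isometric p 1 3 0 2 4)|
  apply (antipodal_isometric p 1 4 0 2 3)|apply (antipodal_isometric p 2 3 0 1 4)|
  apply (antipodal_isometric p 2 4 0 1 3)|apply (antipodal_isometric p 3 4 0 1 2)|lia];
  solve [exact Hp|exact Hn|exact E|cbn; lia|repeat constructor; cbn; lia|cbn [eidx]; lra].
Qed.

Theorem theorem1p4 (s : R) (hs : -2 < s <= 13) (hs0 : s <> 0) :
  (forall p : nat -> pt, config5 p -> energy s tbp <= energy s p) /\
  (forall p : nat -> pt, config5 p -> energy s p = energy s tbp -> isometric5 p tbp).
Proof.
assert (Hst : 0 < Rsign s * (s / 2)).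
{ unfold Rsign. destruct (Rlt_dec 0 s); [lra|]. destruct (Rlt_dec s 0); lra. }
assert (H := fun p (Hp : config5 p) => potential_bound (Rsign s) (s / 2) (edge_dot p) Hst ltac:(lra)
  (gram_edge_dot p (proj1 Hp)) (edge_dot_range p Hp)).
assert (HE : forall p, config5 p -> energy s p
  = total_of (fun y => Rsign s * Rpower (4 - 2 * y) (- (s / 2))) (edge_dot p)).
{ intros p Hp. apply energy_total; [apply Hp|]. intros k Hk. now apply edge_dot_range. }
rewrite energy_tbp. split; intros p Hp; rewrite HE by easy; destruct (H p Hp) as [H1 H2].
- exact H1.
- intros E. destruct (H2 E) as [N1 N2]. apply nodes_isometric; [apply Hp|exact N1|exact N2].
Qed.
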